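(* Let $\ell,\ell_1,\ell_2\in[1,2h]$, $w_1,w_2\in\mathbb{Z}_{q+1}$, and let $X_j=C_{\ell_j}^{w_j}$, $j=1,2$, be simple objects of $\mathcal{E}(\mathrm{SL}(2,q))$. Suppose $\epsilon_1,\epsilon_2\in\{\pm1\}$ satisfy $f^\ell=f^{\epsilon_1\ell_1}f^{\epsilon_2\ell_2}$, i.e. $\epsilon_1\ell_1+\epsilon_2\ell_2\equiv\ell\pmod{q+1}$. Then, for $X=X_1\odot X_2$, there is an isomorphism $$X_{[\mathbf c^\ell]}\cong C_\ell^{\epsilon_1w_1+\epsilon_2w_2},\qquad \mathbf c^{\epsilon_1\ell_1}\otimes\mathbf c^{\epsilon_2\ell_2}\mapsto\mathbf c^\ell,$$ and with respect to this isomorphism and the analogous one for $X_2\odot X_1$ (given by $\mathbf c^{\epsilon_2\ell_2}\otimes\mathbf c^{\epsilon_1\ell_1}\mapsto\mathbf c^\ell$), the restriction of the braiding $R_{X_1,X_2}$ to $X_{[\mathbf c^\ell]}$ is $$R_{[\mathbf c^\ell]}=\zeta_{q+1}^{\epsilon_1\epsilon_2\ell_1w_2}\,\mathrm{id}.$$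
   Context: General setting. For a finite group $\Gamma$, $\mathcal{E}(\Gamma)$ is the category of finite-dimensional representations of the quantum double $D(\Gamma)$. Its objects are $\Gamma$-graded finite-dimensional complex vector spaces $U=\bigoplus_{x\in\Gamma}U_x$ with a left linear action $g\mapsto L^U_g$ of $\Gamma$ with $L^U_g(U_x)=U_{gxg^{-1}}$; morphisms are grading-preserving equivariant linear maps. Tensor product: $(U\odot V)_x=\bigoplus_{x_1x_2=x}U_{x_1}\otimes V_{x_2}$ with diagonal action. Braiding: $R_{U,V}:U\odot V\to V\odot U$ sends $u\otimes v\in U_x\otimes V_y$ to $L^V_x(v)\otimes u\in V_{xyx^{-1}}\otimes U_x$. For $x\in\Gamma$ and an irreducible representation $\rho$ of the centralizer $\mathrm{Cen}(x)$ on $U(\rho)$, $U(x,\rho)$ is the simple object with $U(x,\rho)_y=U(\rho)$ for $y\in[x]$ (the conjugacy class of $x$), $0$ otherwise, with the induced action: fix left coset representatives $R_x$ of $\mathrm{Cen}(x)$; for $g\in\Gamma$, $a\in R_x$ write $ga=a'b$ with $a'\in R_x$, $b\in\mathrm{Cen}(x)$, and let $L_g:U(x,\rho)_{axa^{-1}}\to U(x,\rho)_{a'xa'^{-1}}$ be $\rho(b)$. For an object $X$, $X_{[x]}=\bigoplus_{y\in[x]}X_y$ is the subobject supported on $[x]$; a morphism out of $X_{[x]}$ is determined by its restriction to $X_x$. Notation for $\mathrm{SL}(2,q)$. $q=p^n\ge5$, $p$ an odd prime, $q=4h+1$; $\Gamma=\mathrm{SL}(2,q)$. For integers $a<b$,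 $[a,b]=\{a,a+1,\dots,b\}$. $\check e$ is a fixed generator of $\mathbb{F}_{q^2}^\times$, $\tilde e=\check e^{2h+1}$, $f=\check e^{4h}$ (of multiplicative order $q+1$); $\zeta_m=\exp(2\pi i/m)$. $\mathbf{c}=\begin{pmatrix}s_1&s_1'\tilde e^{-1}\\ s_1'\tilde e&s_1\end{pmatrix}\in\mathrm{SL}(2,q)$ with $s_1=\frac12(f+f^{-1})$, $s_1'=\frac12(f-f^{-1})$; $\mathrm{Cen}(\mathbf c^\ell)=\langle\mathbf c\rangle\cong\mathbb{Z}_{q+1}$ for $\ell\in[1,2h]$, and $\mathbf c^{\ell}$ is conjugate to $\mathbf c^{-\ell}$. For $w\in\mathbb{Z}_{q+1}$, $C_\ell^w=U(\mathbf c^\ell,w^* )$ with $w^*(\mathbf c^{i})=\zeta_{q+1}^{iw}$. Each nonzero component of $C_\ell^w$ is one-dimensional, and its basis vector $1\in\mathbb{C}$ at degree $y$ is denoted by $y$ itself. *)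

(* Defs.v *)
From HB Require Import structures.
From mathcomp Require Import all_boot all_order all_algebra all_fingroup.
From mathcomp Require Import all_solvable all_field all_character.
From mathcomp Require Import complex.
From mathcomp Require Import reals trigo.
From mathcomp Require Import ring.

Set Implicit Arguments.
Unset Strict Implicit.
Unset Printing Implicit Defensive.

Import Order.TTheory GRing.Theory Num.Theory VectorInternalTheory.
Local Open Scope ring_scope.

(* U (x) V in coordinates: u (x) v is the matrix of products of coordinates of
   u and v, and tliftE is the universal property.  v2r : V -> 'rV_(dim V) is
   the coordinate isomorphism that comes with a vectType. *)

Section Tensor.
Variable K : fieldType.
Implicit Types U V W : vectType K.

Definition tensor U V : vectType K := 'M[K]_(dim U, dim V).

Definition tens U V (u : U) (v : V) : tensor U V := (v2r u)^T *m v2r v.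

Definition vb V (i : 'I_(dim V)) : V := r2v (delta_mx 0 i).

Lemma vb_sum V (v : V) : v = \sum_i v2r v 0 i *: vb i.
Proof.
apply: v2r_inj; rewrite linear_sum {1}[v2r v]row_sum_delta /=.
by apply: eq_bigr => i _; rewrite linearZ /= r2vK.
Qed.

Lemma tensE U V (u : U) (v : V) i j : tens u v i j = v2r u 0 i * v2r v 0 j.
Proof. by rewrite /tens mxE big_ord1 !mxE. Qed.

Lemma tens_linear_l U V (v : V) : linear (fun u : U => tens u v).
Proof.
move=> a u u'; apply/matrixP=> i j.
transitivity (a * tens u v i j + tens u' v i j); last by rewrite !mxE.
by rewrite !tensE linearP 2!mxE mulrDl mulrA.
Qed.

Lemma tens_linear_r U V (u : U) : linear (@tens U V u).
Proof.
move=> a v v'; apply/matrixP=> i j.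
transitivity (a * tens u v i j + tens u v' i j); last by rewrite !mxE.
by rewrite !tensE linearP 2!mxE mulrDr mulrCA.
Qed.

Lemma tens_suml U V (I : finType) (u : I -> U) (v : V) :
  tens (\sum_i u i) v = \sum_i tens (u i) v.
Proof.
apply/matrixP=> i j; rewrite tensE linear_sum !summxE mulr_suml.
by apply: eq_bigr => k _; rewrite tensE.
Qed.

Lemma tens_sumr U V (I : finType) (u : U) (v : I -> V) :
  tens u (\sum_i v i) = \sum_i tens u (v i).
Proof.
apply/matrixP=> i j; rewrite tensE linear_sum !summxE mulr_sumr.
by apply: eq_bigr => k _; rewrite tensE.
Qed.

Definition tlift_fun U V W (B : U -> V -> W) (M : tensor U V) : W :=
  \sum_i \sum_j M i j *: B (vb i) (vb j).

Lemma tlift_fun_linear U V W (B : U -> V -> W) : linear (tlift_fun B).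
Proof.
move=> a M N; rewrite /tlift_fun scaler_sumr -big_split /=; apply: eq_bigr => i _.
rewrite scaler_sumr -big_split /=; apply: eq_bigr => j _.
by rewrite !mxE scalerDl scalerA.
Qed.
HB.instance Definition _ U V W (B : U -> V -> W) :=
  GRing.isLinear.Build K (tensor U V) W _ (tlift_fun B) (@tlift_fun_linear U V W B).

Definition tlift U V W (B : U -> V -> W) : 'Hom(tensor U V, W) :=
  linfun (tlift_fun B).

Definition is_bilinear U V W (B : U -> V -> W) : Prop :=
  (forall v, linear (B^~ v)) /\ (forall u, linear (B u)).

Lemma is_bilinear_suml U V W (B : U -> V -> W) : is_bilinear B ->
  forall (I : finType) (P : pred I) (c : I -> K) (u : I -> U) v,
  B (\sum_(i | P i) c i *: u i) v = \sum_(i | P i) c i *: B (u i) v.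
Proof.
move=> [Bl _] I P c u v /=.
pose f := HB.pack_for {linear U -> W} (B^~ v) (GRing.isLinear.Build K U W _ _ (Bl v)).
rewrite -[B _ v]/(f _) linear_sum; apply: eq_bigr => i _; exact: linearZ.
Qed.

Lemma is_bilinear_sumr U V W (B : U -> V -> W) : is_bilinear B ->
  forall (I : finType) (P : pred I) (c : I -> K) u (v : I -> V),
  B u (\sum_(i | P i) c i *: v i) = \sum_(i | P i) c i *: B u (v i).
Proof.
move=> [_ Br] I P c u v.
pose f := HB.pack_for {linear V -> W} (B u) (GRing.isLinear.Build K V W _ _ (Br u)).
rewrite -[B u _]/(f _) linear_sum; apply: eq_bigr => i _; exact: linearZ.
Qed.

Lemma tliftE U V W (B : U -> V -> W) : is_bilinear B ->
  forall u v, tlift B (tens u v) = B u v.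
Proof.
move=> bB u v; rewrite /tlift lfunE /= /tlift_fun.
rewrite [in RHS](vb_sum u) is_bilinear_suml //; apply: eq_bigr => i _.
rewrite [in RHS](vb_sum v) is_bilinear_sumr // scaler_sumr; apply: eq_bigr => j _.
by rewrite tensE scalerA.
Qed.

Lemma tens_span U V (M : tensor U V) :
  M = \sum_i \sum_j M i j *: tens (vb i) (vb j).
Proof.
rewrite [LHS](matrix_sum_delta M); apply: eq_bigr => i _; apply: eq_bigr => j _.
congr (_ *: _); apply/matrixP=> k l; rewrite tensE !r2vK !mxE eqxx /=.
by rewrite -natrM mulnb.
Qed.

Lemma tensor_lfunP U V W (f g : 'Hom(tensor U V, W)) :
  (forall u v, f (tens u v) = g (tens u v)) -> f = g.
Proof.
move=> fg; apply/lfunP=> M; rewrite (tens_span M) !linear_sum.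
apply: eq_bigr => i _; rewrite !linear_sum; apply: eq_bigr => j _.
by rewrite !linearZ /= fg.
Qed.

Definition tensf U U' V V' (f : 'Hom(U, U')) (g : 'Hom(V, V')) :
  'Hom(tensor U V, tensor U' V') := tlift (fun u v => tens (f u) (g v)).

Lemma tensfE U U' V V' (f : 'Hom(U, U')) (g : 'Hom(V, V')) u v :
  tensf f g (tens u v) = tens (f u) (g v).
Proof.
rewrite tliftE //; split=> [w a x y|w a x y]; rewrite linearP.
  by rewrite tens_linear_l.
by rewrite tens_linear_r.
Qed.

Lemma is_bilinear_tens U V : is_bilinear (@tens U V).
Proof. by split=> [v|u]; [apply: tens_linear_l|apply: tens_linear_r]. Qed.

(* The subspace A (x) B of U (x) V. *)
Definition tensv U V (A : {vspace U}) (B : {vspace V}) : {vspace tensor U V} :=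
  <<[seq tens u v | u <- vbasis A, v <- vbasis B]>>%VS.

Lemma mem_tensv U V (A : {vspace U}) (B : {vspace V}) u v :
  u \in A -> v \in B -> tens u v \in tensv A B.
Proof.
move=> /coord_vbasis -> /coord_vbasis ->.
rewrite (is_bilinear_suml (is_bilinear_tens U V)); apply: memv_suml => i _.
apply: memvZ; rewrite (is_bilinear_sumr (is_bilinear_tens U V)).
apply: memv_suml => j _; apply: memvZ; apply: memv_span.
by apply/allpairsP; exists ((vbasis A)`_i, (vbasis B)`_j); split; rewrite ?mem_nth ?size_tuple.
Qed.

Lemma tensv_subP U V (A : {vspace U}) (B : {vspace V}) (W : {vspace tensor U V}) :
  (forall u v, u \in A -> v \in B -> tens u v \in W) -> (tensv A B <= W)%VS.
Proof.
move=> h; apply/span_subvP=> _ /allpairsP[[u v] /= [uA vB ->]].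
by apply: h; apply: vbasis_mem.
Qed.

End Tensor.


Section DirectSum.
Variables (K : fieldType) (V : vectType K) (I : finType).

(* directv is not extensional: applied to a W that is itself a sum it would
   also assert that the inner sums are direct. *)
Definition is_direct (W : I -> {vspace V}) : bool := directv (\sum_i W i).

Lemma directv_proj (W : I -> {vspace V}) (P : I -> 'End(V)) :
  (forall i w, w \in W i -> P i w = w) ->
  (forall i j w, i != j -> w \in W i -> P j w = 0) ->
  is_direct W.
Proof.
move=> Pid P0; apply/directv_sum_independent=> us usW us0 i _.
have := congr1 (P i) us0; rewrite linear0 linear_sum (bigD1 i) //= Pid ?usW //.
rewrite big1 ?addr0 // => j ji; exact: (P0 j i _ ji (usW j isT)).
Qed.

End DirectSum.

Section Category.
Variables (K : fieldType) (gT : finGroupType).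

(* The category E(Gamma) for Gamma the whole type gT: a Gamma-graded space with
   components hcomp x, and the left action g |-> act g. *)
Record ydobj := YDObj {
  yd_space :> vectType K;
  hcomp : gT -> {vspace yd_space};
  act : gT -> 'End(yd_space);
  hcomp_direct : is_direct hcomp;
  hcomp_full : (\sum_x hcomp x)%VS = fullv;
  act1 : act 1%g = \1%VF;
  actM : forall g h, act (g * h)%g = (act g \o act h)%VF;
  act_hcomp : forall g x, (act g @: hcomp x)%VS = hcomp (g * x * g^-1)%g
}.

Implicit Types X Y U V : ydobj.

Record ydmor X Y := YDMor {
  yd_fun :> 'Hom(X, Y);
  yd_fun_hcomp : forall x, (yd_fun @: hcomp X x <= hcomp Y x)%VS;
  yd_fun_act : forall g, (yd_fun \o act X g = act Y g \o yd_fun)%VF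
}.

Record ydiso X Y := YDIso {
  iso_fun :> ydmor X Y;
  iso_inv : ydmor Y X;
  iso_funK : (iso_inv \o iso_fun)%VF = \1%VF;
  iso_invK : (iso_fun \o iso_inv)%VF = \1%VF
}.

(* Projection onto the component of degree x along the other components. *)
Definition hproj X x : 'End(X) := sumv_pi_for (esym (hcomp_full X)) x.

Lemma hproj_mem X x u : hproj X x u \in hcomp X x.
Proof. exact: memv_sum_pi. Qed.

Lemma hproj_sum X u : \sum_x hproj X x u = u.
Proof. by rewrite sumv_pi_sum ?memvf. Qed.

Lemma hproj_hcomp X x y u : u \in hcomp X x ->
  hproj X y u = if y == x then u else 0.
Proof.
move=> ux; pose w z := if z == x then u else 0.
have wm z : true -> w z \in hcomp X z.
  by rewrite /w; case: eqP => [->|] // _; rewrite mem0v.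
have /directv_sum_unique /(_ (fun z => hproj X z u) w) := hcomp_direct X.
move=> /(_ (fun z _ => hproj_mem z u) wm); rewrite hproj_sum.
rewrite /w -big_mkcond big_pred1_eq eqxx => /esym/forall_inP /(_ y isT) /eqP ->.
by [].
Qed.

Lemma act_mem X g x u : u \in hcomp X x -> act X g u \in hcomp X (g * x * g^-1)%g.
Proof. by move=> ux; rewrite -act_hcomp memv_img. Qed.

Lemma act_1 X u : act X 1%g u = u.
Proof. by rewrite act1 id_lfunE. Qed.

Lemma act_M X g h u : act X (g * h)%g u = act X g (act X h u).
Proof. by rewrite actM comp_lfunE. Qed.

Lemma act_hcomp_sub (V : vectType K) (c : gT -> {vspace V}) (a : gT -> 'End(V)) :
  a 1%g = \1%VF -> (forall g h, a (g * h)%g = (a g \o a h)%VF) ->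
  (forall g x, (a g @: c x <= c (g * x * g^-1)%g)%VS) ->
  forall g x, (a g @: c x)%VS = c (g * x * g^-1)%g.
Proof.
move=> a1 aM ac g x; apply/eqP; rewrite eqEsubv ac /=.
have -> : c (g * x * g^-1)%g = (a g @: (a g^-1%g @: c (g * x * g^-1)%g))%VS.
  by rewrite -limg_comp -aM mulgV a1 lim1g.
apply: limgS; apply: subv_trans (ac _ _) _.
by rewrite invgK !mulgA mulVg mul1g mulgKV.
Qed.

Section TensorObject.
Variables U V : ydobj.

Definition tensor_hcomp x : {vspace tensor U V} :=
  (\sum_(p : gT * gT | (p.1 * p.2 == x)%g) tensv (hcomp U p.1) (hcomp V p.2))%VS.

Definition tensor_act g : 'End(tensor U V) := tensf (act U g) (act V g).

Lemma mem_tensor_hcomp x y u v :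
  u \in hcomp U x -> v \in hcomp V y -> tens u v \in tensor_hcomp (x * y)%g.
Proof.
move=> ux vy; apply: (subvP (sumv_sup (x, y) _ (subvv _))) => //=.
exact: mem_tensv.
Qed.

Lemma tensor_hcomp_subP x (W : {vspace tensor U V}) :
  (forall y z u v, (y * z)%g = x -> u \in hcomp U y -> v \in hcomp V z ->
    tens u v \in W) -> (tensor_hcomp x <= W)%VS.
Proof.
move=> h; apply/subv_sumP=> -[y z] /= /eqP yz.
by apply: tensv_subP => u v uy vz; apply: (h y z).
Qed.

Definition tensor_hproj x : 'End(tensor U V) :=
  \sum_(p : gT * gT | (p.1 * p.2 == x)%g) tensf (hproj U p.1) (hproj V p.2).

Lemma tensor_hproj_tens x y z u v : u \in hcomp U y -> v \in hcomp V z ->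
  tensor_hproj x (tens u v) = if (y * z == x)%g then tens u v else 0.
Proof.
move=> uy vz; rewrite sum_lfunE.
have E p : tensf (hproj U p.1) (hproj V p.2) (tens u v) =
    if p == (y, z) then tens u v else 0.
  rewrite tensfE (hproj_hcomp _ uy) (hproj_hcomp _ vz).
  case: p => a b /=; rewrite xpair_eqE.
  case: (a == y) => /=; last by rewrite /tens linear0 trmx0 mul0mx.
  by case: (b == z) => //=; rewrite /tens linear0 mulmx0.
under eq_bigr => p _ do rewrite E.
rewrite -big_mkcondr /=; case: ifP => yz.
  rewrite (big_pred1 (y, z)) // => p /=.
  by apply/andP/eqP => [[_ /eqP]|->] //; rewrite yz eqxx.
by rewrite big_pred0 // => p; apply/andP=> -[+ /eqP Ep]; rewrite Ep yz.
Qed.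

Lemma tensor_hcomp_direct : is_direct tensor_hcomp.
Proof.
apply: (directv_proj (P := tensor_hproj)) => [x w|x y w xy] wx.
  have h : (tensor_hcomp x <= lker (tensor_hproj x - \1%VF)%R)%VS.
    apply: tensor_hcomp_subP => y z u v yz uy vz.
    rewrite memv_ker add_lfunE opp_lfunE id_lfunE (tensor_hproj_tens x uy vz).
    by rewrite yz eqxx subrr.
  have := subvP h _ wx; rewrite memv_ker add_lfunE opp_lfunE id_lfunE subr_eq0.
  by move/eqP.
have h : (tensor_hcomp x <= lker (tensor_hproj y))%VS.
  apply: tensor_hcomp_subP => a b u v ab ua vb.
  by rewrite memv_ker (tensor_hproj_tens y ua vb) ab (negPf xy).
by have := subvP h _ wx; rewrite memv_ker => /eqP.
Qed.

Lemma tensor_hcomp_full : (\sum_x tensor_hcomp x)%VS = fullv.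
Proof.
apply/eqP; rewrite eqEsubv subvf /=; apply/subvP=> M _.
rewrite (tens_span M); apply: memv_suml => i _; apply: memv_suml => j _.
apply: memvZ; rewrite -(hproj_sum (vb i : U)) -(hproj_sum (vb j : V)).
rewrite tens_suml; apply: memv_suml => x _.
rewrite tens_sumr; apply: memv_suml => y _.
apply: (subvP (sumv_sup (x * y)%g _ (subvv _))) => //.
exact: mem_tensor_hcomp (hproj_mem _ _) (hproj_mem _ _).
Qed.

Lemma tensor_act1 : tensor_act 1%g = \1%VF.
Proof. by apply: tensor_lfunP => u v; rewrite tensfE !act_1 id_lfunE. Qed.

Lemma tensor_actM g h : tensor_act (g * h)%g = (tensor_act g \o tensor_act h)%VF.
Proof. by apply: tensor_lfunP => u v; rewrite comp_lfunE !tensfE !act_M. Qed.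

Lemma tensor_act_sub g x :
  (tensor_act g @: tensor_hcomp x <= tensor_hcomp (g * x * g^-1)%g)%VS.
Proof.
apply/subvP=> _ /memv_imgP[M Mx ->].
suff h : (tensor_hcomp x <= tensor_act g @^-1: tensor_hcomp (g * x * g^-1)%g)%VS.
  by have := subvP h _ Mx; rewrite memv_preim.
apply: tensor_hcomp_subP => y z u v yz uy vz; rewrite -memv_preim tensfE.
have -> : (g * x * g^-1 = (g * y * g^-1) * (g * z * g^-1))%g.
  by rewrite -yz !mulgA mulgKV.
by apply: mem_tensor_hcomp; apply: act_mem.
Qed.

Definition ydtensor : ydobj := YDObj tensor_hcomp_direct tensor_hcomp_full
  tensor_act1 tensor_actM (act_hcomp_sub tensor_act1 tensor_actM tensor_act_sub).

End TensorObject.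

(* Braiding: u (x) v |-> sum_x L_x v (x) u_x, with u_x the component of u of
   degree x. *)
Section Braiding.
Variables U V : ydobj.

Definition braid_fun (u : U) (v : V) : ydtensor V U :=
  \sum_x tens (act V x v) (hproj U x u).

Definition braid_lfun : 'Hom(ydtensor U V, ydtensor V U) := tlift braid_fun.

Lemma braid_fun_bilinear : is_bilinear braid_fun.
Proof.
split=> [v a u u'|u a v v']; rewrite /braid_fun scaler_sumr -big_split /=;
  apply: eq_bigr => x _; rewrite linearP.
  exact: tens_linear_r.
exact: tens_linear_l.
Qed.

Lemma braid_lfunE x u v :
  u \in hcomp U x -> braid_lfun (tens u v) = tens (act V x v) u.
Proof.
move=> ux; rewrite tliftE; last exact: braid_fun_bilinear.
rewrite /braid_fun (bigD1 x) //= (hproj_hcomp _ ux) eqxx big1 ?addr0 // => y yx.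
by rewrite (hproj_hcomp _ ux) (negPf yx) /tens linear0 mulmx0.
Qed.

Lemma braid_hcomp x :
  (braid_lfun @: hcomp (ydtensor U V) x <= hcomp (ydtensor V U) x)%VS.
Proof.
apply/subvP=> _ /memv_imgP[M Mx ->].
suff h : (hcomp (ydtensor U V) x <= braid_lfun @^-1: hcomp (ydtensor V U) x)%VS.
  by have := subvP h _ Mx; rewrite memv_preim.
apply: tensor_hcomp_subP => y z u v yz uy vz; rewrite -memv_preim (braid_lfunE _ uy).
have -> : x = ((y * z * y^-1) * y)%g by rewrite mulgKV.
exact: (mem_tensor_hcomp (act_mem y vz) uy).
Qed.

Lemma braid_act g :
  (braid_lfun \o act (ydtensor U V) g = act (ydtensor V U) g \o braid_lfun)%VF.
Proof.
apply: tensor_lfunP => u v; rewrite !comp_lfunE -(hproj_sum u).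
rewrite tens_suml !linear_sum.
apply: eq_bigr => x _ /=; set w := hproj U x u.
have wx : w \in hcomp U x by apply: hproj_mem.
have -> : act (ydtensor U V) g (tens w v) = tens (act U g w) (act V g v).
  exact: tensfE.
rewrite (braid_lfunE _ wx) (braid_lfunE _ (act_mem g wx)).
have -> : act (ydtensor V U) g (tens (act V x v) w) =
    tens (act V g (act V x v)) (act U g w) by exact: tensfE.
by congr (tens _ _); rewrite -[LHS]act_M -[RHS]act_M mulgKV.
Qed.

Definition braiding : ydmor (ydtensor U V) (ydtensor V U) :=
  @YDMor (ydtensor U V) (ydtensor V U) braid_lfun braid_hcomp braid_act.

End Braiding.

(* The subobject X_[x], carried by the subspace class_vspace of X. *)
Section ClassPart.
Variables (X : ydobj) (x : gT).

Definition class_vspace : {vspace X} :=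
  (\sum_(y in (x ^: [set: gT])%g) hcomp X y)%VS.

Let W := subvs_of class_vspace.
Let incl : 'Hom(W, X) := linfun vsval.

Definition class_hcomp y : {vspace W} := (incl @^-1: hcomp X y)%VS.

Definition class_act g : 'End(W) :=
  linfun (vsproj class_vspace \o act X g \o vsval).

Lemma mem_class_hcomp y (w : W) : (w \in class_hcomp y) = (vsval w \in hcomp X y).
Proof. by rewrite -memv_preim lfunE. Qed.

Lemma class_hcomp_sub y :
  y \in (x ^: [set: gT])%g -> (hcomp X y <= class_vspace)%VS.
Proof. by move=> yx; apply: sumv_sup (subvv _). Qed.

Lemma act_class_vspace g u : u \in class_vspace -> act X g u \in class_vspace.
Proof.
move=> /memv_sumP[us uys ->]; rewrite linear_sum; apply: memv_suml => y yx.
apply: (subvP (class_hcomp_sub _)) (act_mem g (uys y yx)).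
have -> : (g * y * g^-1 = y ^ g^-1)%g by rewrite conjgE invgK mulgA.
by case/imsetP: yx => z _ ->; rewrite -conjgM memJ_class ?inE.
Qed.

Lemma class_actE g (w : W) : vsval (class_act g w) = act X g (vsval w).
Proof. by rewrite lfunE /= vsprojK // act_class_vspace // subvsP. Qed.

Lemma class_hcomp_direct : is_direct class_hcomp.
Proof.
apply/directv_sum_independent=> us usW us0 y _.
have /directv_sum_independent /(_ (fun z => vsval (us z))) := hcomp_direct X.
move=> h; apply: subvs_inj; rewrite linear0; apply: h => //.
  by move=> z _; rewrite -mem_class_hcomp usW.
by rewrite -linear_sum us0 linear0.
Qed.

Lemma class_hcomp_full : (\sum_y class_hcomp y)%VS = fullv.
Proof.
apply/eqP; rewrite eqEsubv subvf /=; apply/subvP=> w _.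
have /memv_sumP[us uys wE] := subvsP w.
have -> : w = \sum_(y in (x ^: [set: gT])%g) vsproj class_vspace (us y).
  apply: subvs_inj; rewrite wE linear_sum; apply: eq_bigr => y yx /=.
  by rewrite vsprojK // (subvP (class_hcomp_sub yx)) // uys.
apply: memv_suml => y yx; apply: (subvP (sumv_sup y _ (subvv _))) => //.
by rewrite mem_class_hcomp vsprojK ?uys // (subvP (class_hcomp_sub yx)) // uys.
Qed.

Lemma class_act1 : class_act 1%g = \1%VF.
Proof.
by apply/lfunP=> w; apply: subvs_inj; rewrite class_actE act_1 id_lfunE.
Qed.

Lemma class_actM g h : class_act (g * h)%g = (class_act g \o class_act h)%VF.
Proof.
by apply/lfunP=> w; apply: subvs_inj; rewrite comp_lfunE !class_actE act_M.
Qed.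

Lemma class_act_sub g y :
  (class_act g @: class_hcomp y <= class_hcomp (g * y * g^-1)%g)%VS.
Proof.
apply/subvP=> _ /memv_imgP[w wy ->].
by rewrite mem_class_hcomp class_actE act_mem // -mem_class_hcomp.
Qed.

Definition class_part : ydobj := YDObj class_hcomp_direct class_hcomp_full
  class_act1 class_actM (act_hcomp_sub class_act1 class_actM class_act_sub).

Lemma class_part_actE g (w : class_part) :
  vsval (act class_part g w) = act X g (vsval w).
Proof. exact: class_actE. Qed.

Lemma class_incl_hcomp y : (incl @: hcomp class_part y <= hcomp X y)%VS.
Proof.
by apply/subvP=> _ /memv_imgP[w wy ->]; rewrite lfunE -mem_class_hcomp.
Qed.

Lemma class_incl_act g : (incl \o act class_part g = act X g \o incl)%VF.
Proof. by apply/lfunP=> w; rewrite !comp_lfunE ![incl _]lfunE /= class_part_actE. Qed.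

Definition class_incl : ydmor class_part X :=
  @YDMor class_part X incl class_incl_hcomp class_incl_act.

End ClassPart.

(* The restriction f_[x] : X_[x] -> Y_[x] of f : X -> Y. *)
Section Restriction.
Variables (X Y : ydobj) (f : ydmor X Y) (x : gT).

Definition restr_lfun : 'Hom(class_part X x, class_part Y x) :=
  linfun (vsproj (class_vspace Y x) \o f \o vsval).

Lemma restr_lfunE (w : class_part X x) : vsval (restr_lfun w) = f (vsval w).
Proof.
rewrite lfunE /= vsprojK //; have /memv_sumP[us uys ->] := subvsP w.
rewrite linear_sum; apply: memv_suml => y yx.
apply: (subvP (class_hcomp_sub Y yx)).
by apply: (subvP (yd_fun_hcomp f y)); rewrite memv_img // uys.
Qed.

Lemma restr_hcomp y :
  (restr_lfun @: hcomp (class_part X x) y <= hcomp (class_part Y x) y)%VS.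
Proof.
apply/subvP=> _ /memv_imgP[w wy ->]; rewrite mem_class_hcomp restr_lfunE.
by apply: (subvP (yd_fun_hcomp f y)); rewrite memv_img // -mem_class_hcomp.
Qed.

Lemma restr_act g :
  (restr_lfun \o act (class_part X x) g = act (class_part Y x) g \o restr_lfun)%VF.
Proof.
apply/lfunP=> w; apply: subvs_inj.
rewrite !comp_lfunE restr_lfunE !class_part_actE restr_lfunE.
by rewrite -!comp_lfunE yd_fun_act.
Qed.

Definition restr : ydmor (class_part X x) (class_part Y x) :=
  @YDMor (class_part X x) (class_part Y x) restr_lfun restr_hcomp restr_act.

End Restriction.

End Category.


Section SimpleObject.
Variables (K : fieldType) (gT : finGroupType) (x : gT).

Record coset_reps := CosetReps {
  reps :> {set gT};
  repsP : is_transversal reps (lcosets 'C[x] [set: gT]) [set: gT]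
}.

(* U(rho) is the space of column vectors, on which rho b acts by multiplication
   on the left. *)
Variables (T : coset_reps) (n : nat) (rho : mx_representation K 'C[x] n).

(* The coset representative a with a x a^-1 = y. *)
Definition rep_at (y : gT) : gT := repr [set a in reps T | (a * x * a^-1 == y)%g].

Definition cls : finType := {y : gT | y \in (x ^: [set: gT])%g}.

Lemma rep_atP (y : cls) : (rep_at (val y) * x * (rep_at (val y))^-1)%g = val y.
Proof.
suff : rep_at (val y) \in [set a in reps T | (a * x * a^-1 == val y)%g].
  by rewrite inE => /andP[_ /eqP].
have /imsetP[z _ yE] := valP y.
have /and3P[_ _ /forallP/(_ (z^-1 *: 'C[x])%g)] := repsP T.
have -> : (z^-1 *: 'C[x])%g \in lcosets 'C[x] [set: gT].
  by apply/lcosetsP; exists (z^-1)%g; rewrite ?inE.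
move=> /cards1P[a aE].
have : a \in reps T :&: (z^-1 *: 'C[x])%g by rewrite aE set11.
case/setIP=> aT /lcosetP[b /cent1P bx ab].
suff /mem_repr : a \in [set a in reps T | (a * x * a^-1 == val y)%g] by [].
rewrite inE aT /= ab invMg invgK yE conjgE.
by apply/eqP; rewrite -!mulgA (mulgA b) bx -mulgA mulKVg.
Qed.

Lemma cls_conj_subproof (g : gT) (y : cls) : (val y ^ g)%g \in (x ^: [set: gT])%g.
Proof. by have /imsetP[z _ ->] := valP y; rewrite -conjgM memJ_class ?inE. Qed.

Definition cls_conj g (y : cls) : cls := Sub (val y ^ g)%g (cls_conj_subproof g y).

(* The direct sum of one copy of U(rho) for each y in [x]. *)
Definition simple_space : vectType K := {ffun cls -> 'cV[K]_n}.

(* The element b of Cen(x) with g a = a' b, where a' is the representative at y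
   and a the one at g^-1 y g. *)
Definition cocyc g (y : cls) : gT :=
  ((rep_at (val y))^-1 * g * rep_at (val (cls_conj g y)))%g.

Lemma cocyc_cent g y : cocyc g y \in ('C[x])%g.
Proof.
have := rep_atP (cls_conj g y); rewrite /= conjgE.
set a := rep_at _ => Ea; have := rep_atP y; set a' := rep_at _ => Ea'.
apply/cent1P; rewrite /cocyc -/a -/a'.
have {Ea}Ea : (a * x = g^-1 * val y * g * a)%g by rewrite -(mulgA g^-1%g) -Ea mulgKV.
have {Ea'}Ea' : (x = a'^-1 * val y * a')%g by rewrite -Ea' !mulgA mulVg mul1g mulgKV.
rewrite /commute -[in LHS]mulgA Ea [in RHS]Ea' !mulgA.
by rewrite !mulgK.
Qed.

Lemma cocyc1 y : cocyc 1%g y = 1%g.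
Proof.
rewrite /cocyc; have -> : cls_conj 1 y = y by apply: val_inj; rewrite /= conjg1.
by rewrite mulg1 mulVg.
Qed.

Lemma cls_conjM g h y : cls_conj (g * h)%g y = cls_conj h (cls_conj g y).
Proof. by apply: val_inj; rewrite /= conjgM. Qed.

Lemma cocycM g h y :
  cocyc (g * h)%g y = (cocyc g y * cocyc h (cls_conj g y))%g.
Proof. by rewrite /cocyc cls_conjM !mulgA mulgK. Qed.

Definition simple_act_fun g (phi : simple_space) : simple_space :=
  [ffun y => rho (cocyc g y) *m phi (cls_conj g y)].

Lemma simple_act_linear g : linear (simple_act_fun g).
Proof.
move=> a u v; apply/ffunP=> y.
by rewrite !ffunE mulmxDr scalemxAr.
Qed.
HB.instance Definition _ g :=
  GRing.isLinear.Build K simple_space simple_space _ (simple_act_fun g)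
    (simple_act_linear g).

Definition simple_act g : 'End(simple_space) := linfun (simple_act_fun g).

Lemma simple_actE g phi y :
  simple_act g phi y = rho (cocyc g y) *m phi (cls_conj g y).
Proof. by rewrite lfunE ffunE. Qed.

(* The vector v of U(rho), placed in degree y (0 when y is not in [x]). *)
Definition simple_vec (y : gT) (v : 'cV[K]_n) : simple_space :=
  [ffun z : cls => if val z == y then v else 0].

Lemma simple_vec_linear y : linear (simple_vec y).
Proof.
move=> a u v; apply/ffunP=> z; rewrite !ffunE.
by case: ifP; rewrite ?scaler0 ?addr0.
Qed.
HB.instance Definition _ y :=
  GRing.isLinear.Build K 'cV[K]_n simple_space _ (simple_vec y)
    (simple_vec_linear y).

Definition simple_hcomp (y : gT) : {vspace simple_space} :=
  limg (linfun (simple_vec y)).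

Lemma mem_simple_hcomp y (phi : simple_space) :
  reflect (forall z : cls, val z != y -> phi z = 0) (phi \in simple_hcomp y).
Proof.
apply: (iffP memv_imgP) => [[v _ ->] z zy|h].
  by rewrite lfunE ffunE (negPf zy).
have [yx|yx] := boolP (y \in (x ^: [set: gT])%g).
  exists (phi (Sub y yx)); rewrite ?memvf //; apply/ffunP=> z.
  rewrite lfunE ffunE; case: eqP => [zy|/eqP/h //].
  by congr (phi _); apply: val_inj; rewrite /= zy.
exists 0; rewrite ?memvf // linear0; apply/ffunP=> z; rewrite [RHS]ffunE h //.
by apply: contraNneq yx => <-; apply: valP.
Qed.

Lemma simple_hcomp_direct : is_direct simple_hcomp.
Proof.
apply/directv_sum_independent=> us usW us0 y _; apply/ffunP=> z.
rewrite [RHS]ffunE; have [zy|zy] := eqVneq (val z) y; last first.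
  by move/mem_simple_hcomp: (usW y isT); apply.
have := congr1 (fun phi : simple_space => phi z) us0.
rewrite sum_ffunE ffunE (bigD1 y) //= big1 ?addr0 // => w wy.
by move/mem_simple_hcomp: (usW w isT); apply; rewrite zy eq_sym.
Qed.

Lemma simple_hcomp_full : (\sum_y simple_hcomp y)%VS = fullv.
Proof.
apply/eqP; rewrite eqEsubv subvf /=; apply/subvP=> phi _.
have -> : phi = \sum_(z : cls) simple_vec (val z) (phi z).
  apply/ffunP=> z; rewrite sum_ffunE (bigD1 z) //= ffunE eqxx big1 ?addr0 // => w wz.
  by rewrite ffunE; case: eqP => // /val_inj zw; rewrite zw eqxx in wz.
apply: memv_suml => z _; apply: (subvP (sumv_sup (val z) _ (subvv _))) => //.
by apply/mem_simple_hcomp => w wz; rewrite ffunE (negPf wz).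
Qed.

Lemma simple_act1 : simple_act 1%g = \1%VF.
Proof.
apply/lfunP=> phi; apply/ffunP=> y; rewrite simple_actE id_lfunE cocyc1.
rewrite repr_mx1 mul1mx; congr (phi _); apply: val_inj.
by rewrite /= conjg1.
Qed.

Lemma simple_actM g h : simple_act (g * h)%g = (simple_act g \o simple_act h)%VF.
Proof.
apply/lfunP=> phi; apply/ffunP=> y; rewrite comp_lfunE !simple_actE.
by rewrite cocycM cls_conjM repr_mxM ?cocyc_cent // mulmxA.
Qed.

Lemma simple_act_sub g y :
  (simple_act g @: simple_hcomp y <= simple_hcomp (g * y * g^-1)%g)%VS.
Proof.
apply/subvP=> _ /memv_imgP[phi /mem_simple_hcomp phiy ->].
apply/mem_simple_hcomp => z zy; rewrite simple_actE phiy ?mulmx0 //=.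
by apply: contraNneq zy => <-; rewrite conjgE !mulgA mulgV mul1g mulgK.
Qed.

(* U(x, rho), for the coset representatives T. *)
Definition simple : ydobj K gT :=
  @YDObj K gT simple_space simple_hcomp simple_act
    simple_hcomp_direct simple_hcomp_full simple_act1 simple_actM
    (act_hcomp_sub simple_act1 simple_actM simple_act_sub).

End SimpleObject.


Definition zexpg (gT : finGroupType) (g : gT) (z : int) : gT :=
  match z with
  | Posz n => (g ^+ n)%g
  | Negz n => (g ^- n.+1)%g
  end.

(* The i < #[c] with g = c ^+ i, for g in <[c]>. *)
Definition dlog (gT : finGroupType) (c g : gT) : nat :=
  find (fun i => (c ^+ i)%g == g) (iota 0 #[c]%g).

Lemma dlogK (gT : finGroupType) (c g : gT) :
  g \in <[c]>%g -> (c ^+ dlog c g)%g = g.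
Proof.
move=> /cyclePmin[i ic gE].
have hs : has (fun i => (c ^+ i)%g == g) (iota 0 #[c]%g).
  by apply/hasP; exists i; rewrite ?mem_iota ?gE.
have := nth_find 0%N hs; move: hs; rewrite has_find size_iota => lt_dlog.
by rewrite nth_iota // => /eqP.
Qed.


Record SL2 (F : finFieldType) := MkSL2 { sl2mx :> 'M[F]_2; sl2P : \det sl2mx == 1 }.

HB.instance Definition _ (F : finFieldType) := [isSub for @sl2mx F].
HB.instance Definition _ (F : finFieldType) := [Finite of SL2 F by <:].

Section SL2Group.
Variable F : finFieldType.
Implicit Types A B : SL2 F.

Lemma sl2_det A : \det A = 1. Proof. exact/eqP/sl2P. Qed.

Lemma sl2_mul_subproof A B : \det (sl2mx A *m sl2mx B) == 1.
Proof. by rewrite det_mulmx !sl2_det mulr1. Qed.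

Lemma sl2_one_subproof : \det (1%:M : 'M[F]_2) == 1.
Proof. by rewrite det1. Qed.

Lemma sl2_inv_subproof A : \det (invmx A) == 1.
Proof. by rewrite det_inv sl2_det invr1. Qed.

Definition sl2_mul A B : SL2 F := MkSL2 (sl2_mul_subproof A B).
Definition sl2_one : SL2 F := MkSL2 sl2_one_subproof.
Definition sl2_inv A : SL2 F := MkSL2 (sl2_inv_subproof A).

Lemma sl2_mulA : associative sl2_mul.
Proof. by move=> A B C; apply: val_inj; apply: mulmxA. Qed.

Lemma sl2_mul1 : left_id sl2_one sl2_mul.
Proof. by move=> A; apply: val_inj; apply: mul1mx. Qed.

Lemma sl2_mulV : left_inverse sl2_one sl2_inv sl2_mul.
Proof.
move=> A; apply: val_inj; apply: mulVmx.
by rewrite unitmxE sl2_det unitr1.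
Qed.

HB.instance Definition _ :=
  Finite_isGroup.Build (SL2 F) sl2_mulA sl2_mul1 sl2_mulV.

End SL2Group.


(* F_{q^2} is any field Fq2 of order q^2 with an embedding of Fq; ech is the
   generator of its multiplicative group. *)
Record sl2_setting := SL2Setting {
  p_ : nat;
  n_ : nat;
  q_ : nat;
  h_ : nat;
  p_prime : prime p_;
  p_odd : odd p_;
  q_power : q_ = (p_ ^ n_)%N;
  q_ge5 : (5 <= q_)%N;
  q_h : q_ = (4 * h_ + 1)%N;
  Fq : finFieldType;
  Fq2 : finFieldType;
  card_Fq : #|Fq| = q_;
  card_Fq2 : #|Fq2| = (q_ ^ 2)%N;
  iota_ : {rmorphism Fq -> Fq2};
  ech : {unit Fq2};
  ech_gen : generator [set: {unit Fq2}] ech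
}.

Section SL2q.
Variable S : sl2_setting.
Local Notation p := (p_ S).
Local Notation q := (q_ S).
Local Notation h := (h_ S).
Local Notation L := (Fq2 S).
Local Notation e := (val (ech S) : L).

Definition etil : L := e ^+ (2 * h).+1.
Definition f_ : L := e ^+ (4 * h).
Definition s1 : L := 2^-1 * (f_ + f_^-1).
Definition s1' : L := 2^-1 * (f_ - f_^-1).

(* The matrix of c over F_{q^2}. *)
Definition cmx : 'M[L]_2 :=
  \matrix_(i, j) if i == j then s1 else if i == 0 then s1' * etil^-1 else s1' * etil.

Lemma q_gt0 : (0 < q)%N.
Proof. exact: leq_trans (q_ge5 S). Qed.

Lemma q2E : (q ^ 2).-1 = (q.+1 * (4 * h))%N.
Proof. by rewrite q_h addn1 -[in LHS]subn1 -(exp1n 2) subn_sqr subn1 addn1 mulnC. Qed.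

Lemma e_neq0 : e != 0.
Proof. by rewrite -unitfE; apply: (valP (ech S)). Qed.

Lemma e_prim : (q ^ 2).-1.-primitive_root e.
Proof.
have h0 : (0 < (q ^ 2).-1)%N.
  by rewrite -subn1 subn_gt0 (@ltn_exp2r 1 q 2) //; apply: leq_trans (q_ge5 S).
have oe : #[ech S]%g = (q ^ 2).-1.
  by rewrite orderE -(eqP (ech_gen S)) card_finField_unit card_Fq2.
apply/andP; split=> //; apply/forallP=> i; apply/eqP.
rewrite unity_rootE -FinRing.val_unitX -FinRing.val_unit1 (inj_eq val_inj).
rewrite -order_dvdn oe; apply/idP/eqP=> [/dvdn_leq hi|->//].
by apply/eqP; rewrite eqn_leq ltn_ord /= hi.
Qed.

Lemma f_prim : q.+1.-primitive_root f_.
Proof.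
have d : (q.+1 %| (q ^ 2).-1)%N by rewrite q2E dvdn_mulr.
by have := dvdn_prim_root e_prim d; rewrite q2E mulKn.
Qed.

Lemma f_neq0 : f_ != 0.
Proof. by rewrite expf_neq0 // e_neq0. Qed.

Lemma fq : f_ ^+ q = f_^-1.
Proof.
apply: (mulfI f_neq0); rewrite -exprS mulfV ?f_neq0 //.
exact: prim_expr_order f_prim.
Qed.

Lemma etil_neq0 : etil != 0.
Proof. by rewrite expf_neq0 // e_neq0. Qed.

Lemma etilq : etil ^+ q = - etil.
Proof.
have h0 : (0 < h)%N by case: (h_ S) (q_h S) (q_ge5 S) => // ->.
have E : ((2 * h).+1 * (q * 1))%N = ((2 * h).+1 + (2 * h).+1 * (4 * h))%N.
  by rewrite muln1 q_h mulnDr muln1 addnC.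
have N : e ^+ ((2 * h).+1 * (4 * h)) = -1.
  have : (e ^+ ((2 * h).+1 * (4 * h)) ^+ 2 == 1).
    rewrite -exprM; apply/eqP; rewrite -(prim_expr_order e_prim) q2E.
    congr (_ ^+ _); rewrite [in q.+1]q_h addn1 mulnAC; congr (_ * _)%N.
    by rewrite mulSn mulnAC addnC addn2.
  rewrite sqrf_eq1 => /orP[/eqP N1|/eqP //].
  have : ((q ^ 2).-1 %| (2 * h).+1 * (4 * h))%N by rewrite (prim_order_dvd e_prim) N1.
  rewrite q2E dvdn_pmul2r ?muln_gt0 // => /dvdn_leq.
  by move/(_ isT); rewrite ltnS q_h addn1 ltnNge leq_mul2r orbT.
by rewrite /etil -exprM -[q in LHS]muln1 E exprD N mulrN1.
Qed.

Lemma iota_q (x : Fq S) : iota_ S x ^+ q = iota_ S x.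
Proof. by rewrite -rmorphXn /= -card_Fq expf_card. Qed.

Lemma fixed_iota (y : L) : y ^+ q = y -> exists x, iota_ S x = y.
Proof.
move=> yq; have [/codomP[x ->]|yn] := boolP (y \in codom (iota_ S)); first by exists x.
pose P : {poly L} := 'X^q - 'X.
have sP : size P = q.+1.
  by rewrite size_polyDl size_polyXn // size_polyN size_polyX ltnS (leq_trans _ (q_ge5 S)).
have P0 : P != 0 by rewrite -size_poly_eq0 sP.
have R z : z ^+ q = z -> root P z by move=> zq; rewrite /root !hornerE zq subrr.
have rs_root : all (root P) (y :: codom (iota_ S)).
  by rewrite /= R //; apply/allP=> _ /codomP[x ->]; rewrite R // iota_q.
have rs_uniq : uniq (y :: codom (iota_ S)).
  by rewrite /= yn map_inj_uniq ?enum_uniq //; apply: fmorph_inj.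
have := max_poly_roots P0 rs_root rs_uniq.
by rewrite /= size_map -cardE card_Fq sP ltnn.
Qed.

Lemma pcharL : p \in [pchar L].
Proof.
apply: (@card_finPcharP _ p (n_ S * 2)) (p_prime S).
by rewrite card_Fq2 q_power expnM.
Qed.

Lemma addq (x y : L) : (x + y) ^+ q = x ^+ q + y ^+ q.
Proof.
apply: exprDn_pchar; rewrite q_power pnatX pnatE ?p_prime //.
by rewrite pcharL.
Qed.

Lemma oppq (x : L) : (- x) ^+ q = - x ^+ q.
Proof.
apply/eqP; rewrite -addr_eq0 -addq addNr expr0n.
by case: (q_ S) (q_gt0).
Qed.

Lemma two_neq0 : 2 != 0 :> L.
Proof.
rewrite -(dvdn_pcharf pcharL); apply/negP=> dv; have := dvdn_leq (isT : 0 < 2)%N dv.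
by have := prime_gt1 (p_prime S); have := p_odd S; case: (p_ S) => [|[|[|]]].
Qed.

Lemma two_q : (2^-1 : L) ^+ q = 2^-1.
Proof. by rewrite exprVn -(rmorph_nat (iota_ S)) iota_q. Qed.

Lemma s1q : s1 ^+ q = s1.
Proof. by rewrite exprMn two_q addq exprVn fq invrK addrC. Qed.

Lemma s1'q : s1' ^+ q = - s1'.
Proof. by rewrite exprMn two_q addq oppq exprVn fq invrK -mulrN opprB. Qed.

Lemma ord2P (P : 'I_2 -> Prop) : P 0 -> P 1 -> forall i, P i.
Proof.
move=> P0 P1 [[|[|//]] hi].
  by rewrite (_ : Ordinal hi = 0) //; apply: val_inj.
by rewrite (_ : Ordinal hi = 1) //; apply: val_inj.
Qed.

Lemma cmx_q i j : cmx i j ^+ q = cmx i j.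
Proof.
rewrite mxE; case: ifP => _; first exact: s1q.
by case: ifP => _; rewrite exprMn ?exprVn s1'q etilq ?invrN mulrNN.
Qed.

Lemma det2 (K : comNzRingType) (A : 'M[K]_2) :
  \det A = A 0 0 * A 1 1 - A 0 1 * A 1 0.
Proof.
rewrite (expand_det_row _ ord0) !big_ord_recl big_ord0 /cofactor !det_mx11 !mxE /=.
rewrite expr0 mul1r expr1 mulN1r mulrN addr0.
by congr (A _ _ * A _ _ - A _ _ * A _ _); apply: val_inj.
Qed.

Lemma det_cmx : \det cmx = 1.
Proof.
rewrite det2 !mxE /= [s1' / etil * _]mulrACA mulVf ?etil_neq0 // mulr1 -!expr2 subr_sqr.
have -> : s1 - s1' = f_^-1.
  rewrite -mulrBr opprB [f_ + _]addrC addrACA addrN addr0 -mulr2n -[f_^-1 *+ 2]mulr_natl mulKf //.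
  exact: two_neq0.
have -> : s1 + s1' = f_.
  rewrite -mulrDr addrACA addrN addr0 -mulr2n -[f_ *+ 2]mulr_natl mulKf //.
  exact: two_neq0.
by rewrite mulVf ?f_neq0.
Qed.

Lemma c_exists : exists c : SL2 (Fq S), map_mx (iota_ S) c == cmx.
Proof.
have h i j := fixed_iota (cmx_q i j).
have /fin_all_exists[A hA] : forall i, exists x : 'I_2 -> Fq S,
    forall j, iota_ S (x j) = cmx i j.
  by move=> i; apply: (fin_all_exists (h i)).
pose M := \matrix_(i, j) A i j.
have ME : map_mx (iota_ S) M = cmx by apply/matrixP=> i j; rewrite !mxE hA !mxE.
have dM : \det M == 1.
  by rewrite -(fmorph_eq1 (iota_ S)) -det_map_mx ME det_cmx.
by exists (MkSL2 dM); apply/eqP.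
Qed.

(* The element of SL(2, q) with matrix cmx; it is unique, as iota_ is injective. *)
Definition c_ : SL2 (Fq S) := xchoose c_exists.

Lemma c_E : map_mx (iota_ S) c_ = cmx.
Proof. exact/eqP/(xchooseP c_exists). Qed.

End SL2q.

Section Centralizer.
Variable S : sl2_setting.
Local Notation q := (q_ S).
Local Notation h := (h_ S).
Local Notation L := (Fq2 S).
Local Notation f := (f_ S).
Local Notation et := (etil S).
Local Notation c := (c_ S).

(* mtor (f ^+ i) is the matrix of c ^+ i. *)
Definition mtor (t : L) : 'M[L]_2 :=
  \matrix_(i, j) if i == j then 2^-1 * (t + t^-1)
                 else if i == 0 then 2^-1 * (t - t^-1) * et^-1
                 else 2^-1 * (t - t^-1) * et.

Lemma mtorM t u : t != 0 -> u != 0 -> mtor t *m mtor u = mtor (t * u).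
Proof.
move=> t0 u0; have e0 := etil_neq0 S; have n2 := two_neq0 S.
apply/matrixP; apply: ord2P; apply: ord2P;
  rewrite !mxE !big_ord_recl big_ord0 !mxE /=; field; by rewrite ?t0 ?u0 ?e0 ?n2.
Qed.

Lemma mtor1 : mtor 1 = 1%:M.
Proof.
have n2 := two_neq0 S.
by apply/matrixP; apply: ord2P; apply: ord2P; rewrite !mxE /= invr1 ?subrr ?mulr0 ?mul0r //;
  rewrite -mulr2n mulVf.
Qed.

Lemma mtor_inj t u : mtor t = mtor u -> t = u.
Proof.
have n2 := two_neq0 S; have e0 := etil_neq0 S.
have E v : v = mtor v 0 0 + mtor v 0 1 * et.
  by rewrite !mxE /= mulfVK // -mulrDr addrACA subrr addr0 -mulr2n -[v *+ 2]mulr_natl mulKf.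
by move=> tu; rewrite (E t) tu -E.
Qed.

Lemma c_powE i : map_mx (iota_ S) (c ^+ i)%g = mtor (f ^+ i).
Proof.
elim: i => [|i IH]; first by rewrite map_mx1 mtor1.
rewrite expgS exprS -(mtorM (f_neq0 S) (expf_neq0 i (f_neq0 S))) -IH.
rewrite -[mtor f]/(cmx S) -c_E.
exact: map_mxM.
Qed.

Lemma sl2_map_inj (g g' : SL2 (Fq S)) :
  map_mx (iota_ S) g = map_mx (iota_ S) g' -> g = g'.
Proof. by move=> E; apply: val_inj; apply: (map_mx_inj E). Qed.

Lemma c_pow_eq i j : (c ^+ i == c ^+ j)%g = (f ^+ i == f ^+ j).
Proof.
apply/eqP/eqP=> [E|E]; last by apply: sl2_map_inj; rewrite !c_powE E.
by apply: mtor_inj; rewrite -!c_powE E.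
Qed.

Lemma c_order : #[c]%g = q.+1.
Proof.
apply/eqP; rewrite eqn_dvd; apply/andP; split.
  by rewrite order_dvdn -(expg0 c) c_pow_eq (prim_expr_order (f_prim S)).
by rewrite (prim_order_dvd (f_prim S)) -(expr0 f) -c_pow_eq expg_order.
Qed.

Lemma cent_c l : (1 <= l <= 2 * h)%N -> ('C[(c ^+ l)%g] = <[c]>)%g.
Proof.
move=> /andP[l0 lh]; apply/eqP; rewrite eqEsubset; apply/andP; split; last first.
  by rewrite cycle_subG; apply/cent1P/commuteX.
have n2 := two_neq0 S; have e0 := etil_neq0 S; have f0 := f_neq0 S.
apply/subsetP=> g /cent1P gc.
pose A := map_mx (iota_ S) g.
have AM : A *m mtor (f ^+ l) = mtor (f ^+ l) *m A.
  rewrite -c_powE -!map_mxM; congr map_mx.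
  exact: (congr1 val gc).
have AE i j : A i j ^+ q = A i j by rewrite mxE iota_q.
have dA : A 0 0 * A 1 1 - A 0 1 * A 1 0 = 1.
  by rewrite -det2 det_map_mx sl2_det rmorph1.
have fl : f ^+ l - (f ^+ l)^-1 != 0.
  rewrite subr_eq0; apply/negP=> /eqP fl.
  have : f ^+ (l + l) == 1 by rewrite exprD {1}fl mulVf // expf_neq0.
  rewrite -(prim_order_dvd (f_prim S)) => /dvdn_leq.
  rewrite addn_gt0 l0 => /(_ isT); apply/negP; rewrite -ltnNge ltnS addnn.
  rewrite q_h addn1; apply: leq_trans (leqnSn _).
  by rewrite (_ : 4 * h = (2 * h).*2)%N ?leq_double // -mul2n mulnA.
have nz : 2^-1 * (f ^+ l - (f ^+ l)^-1) != 0 by rewrite mulf_neq0 ?invr_neq0.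
have E00 := congr1 (fun M : 'M[L]_2 => M 0 0) AM.
have E01 := congr1 (fun M : 'M[L]_2 => M 0 1) AM.
move: E00 E01; rewrite /= !mxE !big_ord_recl !big_ord0 !mxE /=.
have -> : lift ord0 ord0 = 1 :> 'I_2 by apply: val_inj.
have -> : ord0 = 0 :> 'I_2 by apply: val_inj.
rewrite /= !addr0.
move: nz; set b := 2^-1 * _ => nz; set a := 2^-1 * _.
move: dA (AE 0 0) (AE 0 1); rewrite !mxE /=.
set x := iota_ S (g 0 0); set y := iota_ S (g 0 1).
set z := iota_ S (g 1 0); set w := iota_ S (g 1 1) => dA xq yq E00 E01.
have zE : z = y * et ^+ 2.
  have /(mulfI nz) : b * (y * et) = b * (z / et).
    transitivity (x * a + y * (b * et) - a * x); first by ring.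
    by rewrite E00; ring.
  by move/(congr1 (fun v => v * et)) => /=; rewrite mulfVK // => <-; ring.
have wE : w = x.
  have /(mulfI nz) : b * (w / et) = b * (x / et).
    transitivity (a * y + b / et * w - y * a); first by ring.
    by rewrite -E01; ring.
  by move/(congr1 (fun v => v * et)) => /=; rewrite !mulfVK.
have t1 : (x + y * et) * (x - y * et) = 1 by rewrite -dA zE wE; ring.
have t0 : x + y * et != 0.
  by apply: contra_eq_neq t1 => ->; rewrite mul0r eq_sym oner_neq0.
have tV : (x + y * et)^-1 = x - y * et by apply: (mulfI t0); rewrite t1 mulfV.
have tq : (x + y * et) ^+ q.+1 = 1.
  by rewrite exprS addq exprMn xq yq etilq mulrN t1.
have [i tE] := prim_rootP (f_prim S) tq.
have -> : g = (c ^+ i)%g; last by rewrite mem_cycle.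
apply: sl2_map_inj; rewrite c_powE -tE.
apply/matrixP; apply: ord2P; apply: ord2P; rewrite !mxE /= tV -/x -/y -/z -/w;
  rewrite ?zE ?wE; field; by rewrite ?n2 ?e0.
Qed.

End Centralizer.


Section Objects.
Variable R : realType.
Local Notation C := R[i].

(* exp (2 pi i / m) = cos (2 pi / m) + i sin (2 pi / m) *)
Definition zeta (m : nat) : C :=
  (cos (2 * pi / m%:R) +i* sin (2 * pi / m%:R))%C.

Lemma cisX (a : R) n :
  (cos a +i* sin a)%C ^+ n = (cos (a *+ n) +i* sin (a *+ n))%C.
Proof.
elim: n => [|n IH]; first by rewrite expr0 mulr0n cos0 sin0.
rewrite exprS IH mulrS cosD sinD; simpc; congr (_ +i* _)%C.
by rewrite addrC [sin a * _]mulrC [cos a * _]mulrC addrC.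
Qed.

Lemma zeta_order m : (0 < m)%N -> zeta m ^+ m = 1.
Proof.
move=> m0; rewrite cisX -[(2 * pi / m%:R) *+ m]mulr_natr mulfVK ?pnatr_eq0 -?lt0n //.
by rewrite mulr_natl cos2pi sin2pi.
Qed.

Variable S : sl2_setting.
Local Notation q := (q_ S).
Local Notation h := (h_ S).
Local Notation c := (c_ S).

(* w^* (c ^+ i) = zeta_(q+1) ^+ (i * w), see wstarE. *)
Definition wstar_fun (w : 'Z_q.+1) (g : SL2 (Fq S)) : 'M[C]_1 :=
  (zeta q.+1 ^+ (dlog c g * w))%:M.

Lemma wstarE w i : wstar_fun w (c ^+ i)%g = (zeta q.+1 ^+ (i * w))%:M.
Proof.
congr (_%:M); rewrite -(expr_mod _ (zeta_order (ltn0Sn q))).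
rewrite -[RHS](expr_mod _ (zeta_order (ltn0Sn q))); congr (_ ^+ _).
rewrite -modnMml -[RHS]modnMml; congr ((_ * _) %% _)%N.
have := dlogK (mem_cycle c i) => /eqP; rewrite eq_expg_mod_order c_order => /eqP ->.
by [].
Qed.

Section Wstar.
Variables (l : nat) (hl : (1 <= l <= 2 * h)%N) (w : 'Z_q.+1).

Lemma wstar_repr : mx_repr 'C[(c ^+ l)%g] (wstar_fun w).
Proof.
split=> [|g g']; first by rewrite -(expg0 c) wstarE mul0n expr0.
rewrite cent_c // => /cycleP[i ->] /cycleP[j ->].
by rewrite -expgD !wstarE mulnDl exprD -scalar_mxM.
Qed.

Definition wstar : mx_representation C 'C[(c ^+ l)%g] 1 :=
  MxRepresentation wstar_repr.

Variable T : forall x : SL2 (Fq S), coset_reps x.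

(* C_l^w = U(c^l, w^* ) *)
Definition Cobj : ydobj C (SL2 (Fq S)) := simple (T (c ^+ l)%g) wstar.

(* The basis vector of the component of C_l^w of degree y, for y in [c^l]. *)
Definition Cvec (y : SL2 (Fq S)) : Cobj := simple_vec (c ^+ l)%g y (const_mx 1).

End Wstar.
End Objects.

(* Main.v *)
(* The component of X_1 (x) X_2 of degree c^l is spanned by the tensors u (x) v
   with u, v of degrees y, z in the classes of c^l1, c^l2 such that y z = c^l.
   Since f^l = f^(e1 l1) f^(e2 l2), this triangle is degenerate: prescribing
   tr y and tr (y^-1 c^l) leaves only y = c^(e1 l1).  So the component is a line,
   on which Cen(c^l) = <c> acts by the character of weight e1 w1 + e2 w2, and an
   object supported on [x] with such a line in degree x is U(x, rho).  An
   endomorphism of it is a scalar, read off on the generating vector, where the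
   braiding only lets c^(e1 l1) act on the second factor. *)

Require Import Defs.
From HB Require Import structures.
From mathcomp Require Import all_boot all_order all_algebra all_fingroup.
From mathcomp Require Import all_solvable all_field all_character.
From mathcomp Require Import complex.
From mathcomp Require Import reals trigo.
From mathcomp Require Import ring zify.

Set Implicit Arguments.
Unset Strict Implicit.
Unset Printing Implicit Defensive.

Import Order.TTheory GRing.Theory Num.Theory VectorInternalTheory.
Local Open Scope ring_scope.

(* Both names are shadowed by MathComp: actions and simple groups. *)
Local Notation act := Defs.act.
Local Notation simple := Defs.simple.

(** * Pure tensors *)

Lemma tens0l (K : fieldType) (U V : vectType K) (v : V) : tens (0 : U) v = 0.
Proof. by rewrite /tens linear0 trmx0 mul0mx. Qed.

Lemma tens0r (K : fieldType) (U V : vectType K) (u : U) : tens u (0 : V) = 0.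
Proof. by rewrite /tens linear0 mulmx0. Qed.

(** A nonzero coordinate of [u] can be cancelled from a row of products. This is what keeps the
    generator of the component of degree c^l nonzero. *)
Lemma tens_eq0 (K : fieldType) (U V : vectType K) (u : U) (v : V) :
  (tens u v == 0) = (u == 0) || (v == 0).
Proof.
apply/eqP/orP => [uv0|[/eqP->|/eqP->]]; rewrite ?tens0l ?tens0r //.
have [_|u0] := eqVneq u 0; [by left|right].
have /rV0Pn[i ui] : v2r u != 0.
  by rewrite -(inj_eq (@r2v_inj K U)) v2rK linear0.
apply/eqP/v2r_inj; rewrite linear0; apply/rowP=> j.
by apply: (mulfI ui); rewrite -tensE uv0 !mxE mulr0.
Qed.

Lemma tensZ (K : fieldType) (U V : vectType K) (a b : K) (u : U) (v : V) :
  tens (a *: u) (b *: v) = (a * b) *: tens u v.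
Proof.
apply/matrixP=> i j; transitivity (a * b * tens u v i j); last by rewrite [RHS]mxE.
by rewrite !tensE !linearZ !mxE mulrACA.
Qed.

(** * Morphisms, their inverses, and the support of [class_part] *)

Section Isomorphisms.
Variables (K : fieldType) (gT : finGroupType).

Lemma ydmor_act (X Y : ydobj K gT) (f : ydmor X Y) g u :
  f (act X g u) = act Y g (f u).
Proof. by rewrite -!comp_lfunE yd_fun_act. Qed.

Section Composition.
Variables (X Y Z : ydobj K gT) (f : ydmor Y Z) (g : ydmor X Y).

Lemma ydcomp_hcomp x : ((f \o g)%VF @: hcomp X x <= hcomp Z x)%VS.
Proof. by rewrite limg_comp (subv_trans (limgS _ (yd_fun_hcomp g x))) ?yd_fun_hcomp. Qed.

Lemma ydcomp_act a : ((f \o g) \o act X a = act Z a \o (f \o g))%VF.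
Proof. by rewrite -comp_lfunA yd_fun_act !comp_lfunA yd_fun_act. Qed.

Definition ydcomp : ydmor X Z := YDMor ydcomp_hcomp ydcomp_act.

End Composition.

(** Each component of [u] goes to the component of the same degree, so only the part of degree [x]
    survives the projection. In particular kernels are graded. *)
Lemma ydmor_hproj (X Y : ydobj K gT) (f : ydmor X Y) x u :
  f (hproj X x u) = hproj Y x (f u).
Proof.
rewrite -{2}(hproj_sum u) !linear_sum (bigD1 x) //= big1 => [|y yx].
  rewrite addr0 (@hproj_hcomp _ _ Y x) ?eqxx //.
  exact: (subvP (yd_fun_hcomp f x)) (memv_img _ (hproj_mem _ _)).
have fy : f (hproj X y u) \in hcomp Y y.
  exact: (subvP (yd_fun_hcomp f y)) (memv_img _ (hproj_mem _ _)).
by rewrite (hproj_hcomp _ fy) eq_sym (negPf yx).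
Qed.

(** The linear inverse respects degrees because [f] commutes with the projections, and it is
    equivariant by cancelling [f]. Here [f] becomes the inverse half: maps out of a simple object
    are easy to build, while an isomorphism onto it is wanted. *)
Lemma ydmor_bij_iso (X Y : ydobj K gT) (f : ydmor X Y) :
    lker f == 0%VS -> limg f = fullv ->
  exists phi : ydiso Y X, iso_inv phi = f.
Proof.
move=> f_inj f_surj; pose g := (f^-1)%VF.
have gK : (g \o f)%VF = \1%VF by apply/lfunP=> u; rewrite comp_lfunE id_lfunE lker0_lfunK.
have fK : (f \o g)%VF = \1%VF.
  apply/lfunP=> w; rewrite comp_lfunE id_lfunE.
  by have /memv_imgP[u _ ->] : w \in limg f; rewrite ?f_surj ?memvf ?lker0_lfunK.
have g_hcomp x : (g @: hcomp Y x <= hcomp X x)%VS.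
  apply/subvP=> _ /memv_imgP[w wx ->].
  suff -> : g w = hproj X x (g w) by apply: hproj_mem.
  (* Both sides have the same image under the injective [f], because [f (g w) = w] is already
     homogeneous of degree [x]. *)
  apply/eqP; rewrite -subr_eq0 -memv0 -(eqP f_inj) memv_ker linearB /= ydmor_hproj.
  have -> : f (g w) = w by rewrite -comp_lfunE fK id_lfunE.
  by rewrite (hproj_hcomp _ wx) eqxx subrr.
have g_act a : (g \o act Y a = act X a \o g)%VF.
  rewrite -[LHS]comp_lfun1r -fK comp_lfunA -[X in (X \o g)%VF]comp_lfunA.
  by rewrite -yd_fun_act comp_lfunA gK comp_lfun1l.
by exists (@YDIso _ _ Y X (YDMor g_hcomp g_act) f fK gK).
Qed.

(** Projection to degree [y] fixes a vector of degree [y], but kills every sum of components whose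
    degrees lie in the class. *)
Lemma class_part_notin (X : ydobj K gT) x y :
  y \notin (x ^: [set: gT])%g -> hcomp (class_part X x) y = 0%VS.
Proof.
move=> yx; apply/eqP; rewrite -subv0; apply/subvP=> s; rewrite mem_class_hcomp memv0 => sy.
rewrite -(inj_eq (@subvs_inj _ _ _)) linear0.
have /esym := hproj_hcomp y sy; rewrite eqxx => ->.
have /memv_sumP[us usx ->] := subvsP s; rewrite linear_sum big1 // => z zx.
by rewrite /= (hproj_hcomp _ (usx z zx)); case: eqP yx => // ->; rewrite zx.
Qed.

End Isomorphisms.

(** * Simple objects of one-dimensional representations *)

Lemma rep_atE (gT : finGroupType) (x : gT) (T : coset_reps x) y :
  y \in (x ^: [set: gT])%g -> (rep_at T y * x * (rep_at T y)^-1)%g = y.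
Proof. by move=> yx; apply: (rep_atP T (Sub y yx : cls x)). Qed.

Section SimpleDim1.
Variables (K : fieldType) (gT : finGroupType) (x : gT).
Variables (T : coset_reps x) (rho : mx_representation K 'C[x] 1).
Local Notation chi b := (rho b 0 0).
Local Notation U := (simple T rho).
Local Notation e y := (simple_vec x y (const_mx 1 : 'cV[K]_1) : U).
Local Notation cl := (x ^: [set: gT])%g.

Lemma mul_mx11 (A B : 'M[K]_1) : A *m B = A 0 0 *: B.
Proof. by rewrite [A in LHS]mx11_scalar mul_scalar_mx. Qed.

Lemma chiM : {in 'C[x]%g &, forall a b, chi (a * b)%g = chi a * chi b}.
Proof. by move=> a b aC bC; rewrite repr_mxM // mul_mx11 mxE. Qed.

Lemma chi_neq0 b : b \in 'C[x]%g -> chi b != 0.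
Proof.
move=> bC; apply/eqP=> chi0; have := chiM bC (groupVr bC).
rewrite chi0 mul0r mulgV repr_mx1 mxE eqxx => /eqP.
by rewrite oner_eq0.
Qed.

Lemma simple_vec_neq0 y : y \in cl -> e y != 0.
Proof.
move=> yx; apply/eqP=> /ffunP/(_ (Sub y yx)); rewrite !ffunE eqxx => /matrixP/(_ 0 0).
by rewrite !mxE => /eqP; rewrite oner_eq0.
Qed.

Lemma simple_vec_notin y : y \notin cl -> e y = 0.
Proof.
move=> yx; apply/ffunP=> z; rewrite !ffunE; case: eqP => // zy.
by rewrite -zy (valP z) in yx.
Qed.

Lemma simple_hcompP y (phi : U) : phi \in hcomp U y -> exists k, phi = k *: e y.
Proof.
case/memv_imgP=> v _ ->; exists (v 0 0); rewrite lfunE /=.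
rewrite -[RHS]linearZ /=; congr simple_vec.
by apply/matrixP=> i j; rewrite !ord1 !mxE mulr1.
Qed.

Lemma simple_hcomp_notin y (phi : U) : y \notin cl -> phi \in hcomp U y -> phi = 0.
Proof. by move=> yx /simple_hcompP[k ->]; rewrite simple_vec_notin // scaler0. Qed.

(** With a the representative at [y], one has g a = a b for b = a^-1 g a, which centralizes [x]; the
    induced action is therefore multiplication by [chi b]. *)
Lemma simple_act_vec g y : y \in cl ->
  (g * y = y * g)%g -> act U g (e y) = chi ((rep_at T y)^-1 * g * rep_at T y)%g *: e y.
Proof.
move=> yx gy; have yg : (y ^ g = y)%g by apply/conjg_fixP/commgP.
apply/ffunP=> z; rewrite [LHS]simple_actE !ffunE /=.
have -> : (val z ^ g == y)%g = (val z == y) by rewrite -{1}yg (inj_eq (conjg_inj g)).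
case: eqP => [zy|_]; last by rewrite mulmx0 scaler0.
by rewrite mul_mx11 /cocyc /= zy yg.
Qed.

Lemma mem_cls : x \in cl.
Proof. exact: class_refl. Qed.

Lemma rep_at_cent : rep_at T x \in 'C[x]%g.
Proof.
apply/cent1P; rewrite /commute; apply: (mulIg (rep_at T x)^-1%g); rewrite mulgK.
exact: rep_atE mem_cls.
Qed.

(** With a the representative at [y], the product of a and [rep_at T x] already has the form a b
    with b = [rep_at T x], which gives the scalar. *)
Lemma simple_act_rep (y : cls x) :
  act U (rep_at T (val y)) (e x) = chi (rep_at T x) *: e (val y).
Proof.
have ya := rep_atP T y; set a := rep_at T (val y).
have yax : (val y ^ a = x)%g by rewrite -ya conjgE !mulgA mulVg mul1g mulgKV.
apply/ffunP=> z; rewrite [LHS]simple_actE !ffunE /=.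
have -> : (val z ^ a == x)%g = (val z == val y) by rewrite -(inj_eq (conjg_inj a) (val z)) yax.
case: eqP => [zy|_]; last by rewrite mulmx0 scaler0.
by rewrite mul_mx11 /cocyc /= zy yax /a mulVg mul1g.
Qed.

Lemma simple_sum (phi : U) : phi = \sum_(y : cls x) phi y 0 0 *: e (val y).
Proof.
apply/ffunP=> z; rewrite sum_ffunE (bigD1 z) //= big1 => [|y yz].
  rewrite addr0 !ffunE eqxx; apply/matrixP=> i j.
  by rewrite !ord1 !mxE mulr1.
by rewrite !ffunE (inj_eq val_inj) eq_sym (negPf yz) scaler0.
Qed.

(** Up to a nonzero scalar every [e y] is a translate of [e x], so equivariance propagates the
    eigenvalue from [e x] to the whole space. *)
Lemma simple_endo_scalar (f : ydmor U U) k :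
  f (e x) = k *: e x -> yd_fun f = k *: \1%VF.
Proof.
move=> fx; apply/lfunP=> phi; rewrite scale_lfunE id_lfunE.
rewrite (simple_sum phi) linear_sum scaler_sumr; apply: eq_bigr => y _.
rewrite linearZ /= scalerA mulrC -scalerA; congr (_ *: _).
apply: (scalerI (chi_neq0 rep_at_cent)).
transitivity (f (act U (rep_at T (val y)) (e x))); first by rewrite simple_act_rep linearZ.
by rewrite ydmor_act fx linearZ /= simple_act_rep !scalerA mulrC.
Qed.

(** * Universal property: morphisms out of U(x, rho) from a vector of weight [chi] *)

Section Universal.
Variables (Z : ydobj K gT) (u : Z).
Hypotheses (ux : u \in hcomp Z x)
           (uact : {in 'C[x]%g, forall b, act Z b u = chi b *: u}).

(* rep_at T x is in Cen(x) but need not be 1: the factor makes e x go to u. *)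
Definition simple_ext (phi : U) : Z :=
  \sum_(y : cls x) phi y 0 0 *: act Z (rep_at T (val y)) ((chi (rep_at T x))^-1 *: u).

Lemma simple_ext_linear : linear simple_ext.
Proof.
move=> a phi phi'; rewrite /simple_ext scaler_sumr -big_split /=.
by apply: eq_bigr => y _; rewrite !ffunE !mxE scalerDl scalerA.
Qed.
HB.instance Definition _ := GRing.isLinear.Build K U Z _ simple_ext simple_ext_linear.

Lemma simple_ext_vec (y : cls x) : simple_ext (e (val y)) =
  act Z (rep_at T (val y)) ((chi (rep_at T x))^-1 *: u).
Proof.
rewrite /simple_ext (bigD1 y) //= big1 => [|z zy].
  by rewrite addr0 ffunE eqxx mxE scale1r.
by rewrite ffunE (inj_eq val_inj) (negPf zy) mxE scale0r.
Qed.

Lemma simple_ext_gen : simple_ext (e x) = u.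
Proof.
rewrite -[x in e x]/(val (Sub x mem_cls : cls x)) simple_ext_vec /=.
by rewrite linearZ /= uact ?rep_at_cent // scalerA mulVf ?scale1r // chi_neq0 ?rep_at_cent.
Qed.

Lemma simple_ext_hcomp y : (linfun simple_ext @: hcomp U y <= hcomp Z y)%VS.
Proof.
apply/subvP=> _ /memv_imgP[phi /simple_hcompP[k ->] ->]; rewrite linearZ /= memvZ //.
rewrite lfunE /=; have [yx|yx] := boolP (y \in cl); last first.
  by rewrite simple_vec_notin // linear0 mem0v.
rewrite -[y in e y]/(val (Sub y yx : cls x)) simple_ext_vec linearZ memvZ //.
by rewrite -[y in hcomp Z y](rep_atE T yx) act_mem.
Qed.

Lemma simple_ext_act g : (linfun simple_ext \o act U g = act Z g \o linfun simple_ext)%VF.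
Proof.
apply/lfunP=> phi; rewrite !comp_lfunE !lfunE /= /simple_ext linear_sum.
have conjK : cancel (cls_conj (x := x) g) (cls_conj g^-1).
  by move=> y; apply: val_inj; rewrite /= conjgK.
have conjVK : cancel (cls_conj (x := x) g^-1) (cls_conj g).
  by move=> y; apply: val_inj; rewrite /= conjgKV.
(* [act U g] moves the coefficient at g^-1 y g to [y], so the right-hand sum is reindexed by
   conjugation. *)
rewrite [RHS](reindex (cls_conj g)) /=; last first.
  by exists (cls_conj g^-1) => y _; rewrite ?conjK ?conjVK.
apply: eq_bigr => y _; rewrite !linearZ /= -act_M.
(* This is the relation g a = a' b that defines the cocycle b; then b acts on [u] through [chi]. *)
have -> : (g * rep_at T (val (cls_conj g y)) = rep_at T (val y) * cocyc T g y)%g.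
  by rewrite /cocyc !mulgA mulgV mul1g.
rewrite act_M [act Z (cocyc _ _ _) _]uact ?cocyc_cent // [act Z _ (_ *: u)]linearZ /=.
rewrite ffunE mul_mx11 mxE !scalerA.
by congr (_ *: _); ring.
Qed.

Definition simple_ext_mor : ydmor U Z := @YDMor _ _ U Z _ simple_ext_hcomp simple_ext_act.

End Universal.

(** The universal property gives a map sending [e y] to a translate of a multiple of [u]. These
    images span the components of [Z] over the class and [Z] has no others, so the map is bijective
    and its inverse is [phi]. *)
Lemma simple_isoP (Z : ydobj K gT) (u : Z) :
    u != 0 -> hcomp Z x = <[u]>%VS ->
    (forall y, y \notin cl -> hcomp Z y = 0%VS) ->
    {in 'C[x]%g, forall b, act Z b u = chi b *: u} ->
  exists phi : ydiso Z U, phi u = e x.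
Proof.
move=> u0 Zx Zcl uact; have ux : u \in hcomp Z x by rewrite Zx memv_line.
pose f := simple_ext_mor ux uact; have fE phi : f phi = simple_ext u phi by rewrite lfunE.
have f_vec y : y \in cl -> f (e y) != 0 /\ hcomp Z y = <[f (e y)]>%VS.
  move=> yx; rewrite fE -[y in e y]/(val (Sub y yx : cls x)) simple_ext_vec /=.
  set a := rep_at T y; have k0 : (chi (rep_at T x))^-1 != 0.
    by rewrite invr_eq0 chi_neq0 ?rep_at_cent.
  have aE := rep_atE T yx; rewrite -/a in aE.
  split.
    apply/eqP=> /(congr1 (act Z a^-1)); rewrite linear0 -act_M mulVg act_1 => /eqP.
    by rewrite scaler_eq0 (negPf k0) (negPf u0).
  rewrite -{1}aE -act_hcomp Zx limg_line linearZ /=.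
  apply/eqP; rewrite eqEsubv -!memvE memvZ ?memv_line // andbT.
  apply/vlineP; exists (chi (rep_at T x)).
  by rewrite scalerA mulfV ?scale1r // chi_neq0 ?rep_at_cent.
have f_inj : lker f == 0%VS.
  rewrite -subv0; apply/subvP=> phi; rewrite memv_ker => /eqP f0; rewrite memv0.
  rewrite (simple_sum phi) big1 // => y _.
  (* Each component of a kernel vector is again in the kernel, and it is a multiple of some [e y],
     whose image is nonzero. *)
  have := ydmor_hproj f (val y) phi; rewrite f0 linear0.
  have [k kE] := simple_hcompP (hproj_mem (val y) phi).
  rewrite kE linearZ /= => /eqP.
  rewrite scaler_eq0 (negPf (f_vec _ (valP y)).1) orbF => /eqP k0.
  have : hproj U (val y) phi = 0 by rewrite kE k0 scale0r.
  have ph z : phi z 0 0 *: e (val z) \in hcomp U (val z).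
    by rewrite memvZ //; apply/memv_imgP; exists (const_mx 1); rewrite ?memvf ?lfunE.
  rewrite {1}(simple_sum phi) linear_sum (bigD1 y) //= (hproj_hcomp _ (ph y)) eqxx.
  rewrite big1 ?addr0 // => z zy.
  by rewrite (hproj_hcomp _ (ph z)) (inj_eq val_inj) eq_sym (negPf zy).
have f_surj : limg f = fullv.
  apply/eqP; rewrite eqEsubv subvf -(hcomp_full Z); apply/subv_sumP=> y _.
  have [yx|yx] := boolP (y \in cl); last by rewrite Zcl ?sub0v.
  by rewrite (f_vec y yx).2 -memvE memv_img ?memvf.
have [phi phiE] := ydmor_bij_iso f_inj f_surj; exists phi.
rewrite -[u in LHS](simple_ext_gen uact) -fE -phiE -comp_lfunE.
by rewrite iso_invK id_lfunE.
Qed.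

End SimpleDim1.

(** * Integer powers of a group element *)

Section Zexpg.
Variable gT : finGroupType.
Implicit Types x g : gT.

Lemma zexpg_cycle x z : zexpg x z \in <[x]>%g.
Proof. by case: z => n; rewrite /= ?groupV mem_cycle. Qed.

Lemma zexpgJ x z g : (zexpg x z ^ g)%g = zexpg (x ^ g)%g z.
Proof. by case: z => n; rewrite /= ?conjVg conjXg. Qed.

Lemma zexpg_sub_order x n k : zexpg x (n%:Z - (k * #[x]%g)%:Z) = (x ^+ n)%g.
Proof.
have xk : (x ^+ (k * #[x]) = 1)%g by rewrite mulnC expgM expg_order expg1n.
have [kn|nk] := leqP (k * #[x]%g) n.
  by rewrite subzn //= -{2}(subnK kn) expgD xk mulg1.
have -> : n%:Z - (k * #[x]%g)%:Z = Negz (k * #[x]%g - n).-1.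
  by rewrite NegzE prednK ?subn_gt0 // -subzn 1?ltnW // opprB.
rewrite /= prednK ?subn_gt0 //; apply: (mulgI (x ^+ (k * #[x] - n))%g).
by rewrite mulgV -expgD subnK 1?ltnW.
Qed.

(** Subtracting a multiple of the order does not change a power, so facts about natural powers carry
    over to [zexpg]. *)
Lemma zexpg_natP x (z : int) :
  exists n k : nat, z = n%:Z - (k * #[x]%g)%:Z /\ zexpg x z = (x ^+ n)%g.
Proof.
suff [n [k zE]] : exists n k : nat, z = n%:Z - (k * #[x]%g)%:Z.
  by exists n, k; rewrite zE zexpg_sub_order.
case: z => n; first by exists n, 0%N; rewrite mul0n subr0.
(* With o the order, -(n+1) = (n+1)(o-1) - (n+1)o. *)
exists (n.+1 * #[x]%g.-1)%N, n.+1; rewrite NegzE -{2}(prednK (order_gt0 x)) mulnS PoszD.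
by rewrite opprD addrCA subrr addr0.
Qed.

Lemma zexpgM_sign x (e z : int) : e = 1 \/ e = -1 ->
  zexpg (zexpg x e) z = zexpg x (e * z).
Proof.
case=> -> /=; first by rewrite mul1r expg1.
rewrite mulN1r expg1; case: z => [[|n]|n] /=.
- by rewrite expg0.
- by rewrite expgVn.
- by rewrite expgVn invgK.
Qed.

End Zexpg.

(** * Conjugation, traces and factorizations in SL(2, q) *)

Lemma mulmx2E (K : pzRingType) (A B : 'M[K]_2) i j :
  (A *m B) i j = A i 0 * B 0 j + A i 1 * B 1 j.
Proof.
rewrite mxE !big_ord_recl big_ord0 addr0.
by congr (A _ _ * B _ _ + A _ _ * B _ _); apply: val_inj.
Qed.

Section SL2.
Variable S : sl2_setting.
Local Notation q := (q_ S).
Local Notation h := (h_ S).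
Local Notation L := (Fq2 S).
Local Notation f := (f_ S).
Local Notation et := (etil S).
Local Notation c := (c_ S).
Local Notation K := (Fq S).

Lemma zexpg_c_E z : map_mx (iota_ S) (zexpg c z) = mtor (f ^ z).
Proof.
have [n [k [zE ->]]] := zexpg_natP c z; rewrite c_powE zE c_order.
rewrite expfzDr ?f_neq0 // -invr_expz -!exprnP mulnC exprM (prim_expr_order (f_prim S)).
by rewrite expr1n invr1 mulr1.
Qed.

(** As q^2 - 1 = 4h(q+1), the power h(q+1) of the generator has order 4. Its power q - 1 = 4h is 1,
    so it is fixed by Frobenius and comes from F_q. *)
Lemma sqrt_minus1 : exists i : K, i * i = -1.
Proof.
have h0 : (0 < h)%N by case: (h_ S) (q_h S) (q_ge5 S) => // ->.
pose j : L := val (ech S) ^+ (h * q.+1).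
have q2 : ((q ^ 2).-1 = (h * q.+1) * 2 * 2)%N by rewrite q2E; lia.
have jj : j * j = -1.
  have : (j * j) ^+ 2 == 1.
    by rewrite -expr2 /j -!exprM !mulnA -q2 (prim_expr_order (e_prim S)).
  rewrite sqrf_eq1 => /orP[|/eqP //].
  rewrite -expr2 /j -exprM -(prim_order_dvd (e_prim S)) q2 => /dvdn_leq.
  by rewrite !muln_gt0 h0 => /(_ isT); lia.
have jq : j ^+ q = j.
  rewrite (q_h S) addn1 exprS (_ : (4 * h = 2 * (2 * h))%N); last by lia.
  by rewrite exprM expr2 jj exprM sqrrN expr1n expr1n mulr1.
have [i iE] := fixed_iota jq; exists i.
by apply: (fmorph_inj (iota_ S)); rewrite rmorphM rmorphN1 /= iE.
Qed.

(** For i^2 = -1 the matrix diag(i, -i) has determinant 1, and conjugating by it negates the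
    off-diagonal entries; in c this amounts to exchanging f and f^-1. *)
Lemma sl2_conj_diag : exists g : SL2 K, (c ^ g)%g = (c^-1)%g.
Proof.
have [i ii] := sqrt_minus1.
pose D := \matrix_(k, m) (if k == m then if k == 0 then i else - i else 0) : 'M[K]_2.
have dD : \det D == 1 by rewrite det2 !mxE /= mulrN ii opprK mulr0 subr0.
exists (MkSL2 dD); apply: (mulgI (MkSL2 dD)); rewrite conjgE !mulgA mulgV mul1g.
apply: sl2_map_inj.
have -> : (c^-1 = zexpg c (- 1))%g by rewrite /= expg1.
rewrite [LHS](map_mxM (iota_ S)) [RHS](map_mxM (iota_ S)) zexpg_c_E c_E.
apply/matrixP; apply: ord2P; apply: ord2P;
  rewrite !mulmx2E !mxE /= ?rmorph0 ?rmorphN /= exprN1 ?invrK /Defs.s1 /Defs.s1'; ring.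
Qed.

Lemma sign_conj (e : int) : e = 1 \/ e = -1 ->
  exists g, forall z, (zexpg c z ^ g)%g = zexpg c (e * z).
Proof.
move=> eP; suff [g cg] : exists g, (c ^ g)%g = zexpg c e.
  by exists g => z; rewrite zexpgJ cg zexpgM_sign.
case: eP => ->; first by exists 1%g; rewrite conjg1 /= expg1.
by have [g cg] := sl2_conj_diag; exists g; rewrite cg /= expg1.
Qed.

Lemma sign_pow_class (e : int) l : e = 1 \/ e = -1 ->
  zexpg c (e * l%:Z) \in ((c ^+ l) ^: [set: SL2 K])%g.
Proof.
move=> eP; have [g cg] := sign_conj eP.
by rewrite -cg /= memJ_class ?inE.
Qed.

(* Up to Cen(c^l) = <c>, a is the inverse of an element that conjugates c to c^e. *)
Lemma conj_sign_pow (e : int) l (a : SL2 K) z :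
    (1 <= l <= 2 * h)%N -> e = 1 \/ e = -1 ->
    (a * c ^+ l * a^-1)%g = zexpg c (e * l%:Z) ->
  (a^-1 * zexpg c z * a)%g = zexpg c (e * z).
Proof.
move=> hl eP ac; have [g cg] := sign_conj eP.
have ee : e * e = 1 by case: eP => ->.
have gaC : (g * a)%g \in 'C[c ^+ l]%g.
  have := cg l%:Z; rewrite -ac => /= gE.
  apply/cent1P/commute_sym/commgP/conjg_fixP; rewrite conjgM gE.
  by rewrite conjgE !mulgA mulVg mul1g mulgKV.
rewrite (cent_c hl) in gaC.
have -> : a = (g^-1 * (g * a))%g by rewrite mulKg.
move: (g * a)%g gaC => b bc.
have zE : (g * zexpg c z * g^-1)%g = zexpg c (e * z).
  have := cg (e * z); rewrite mulrA ee mul1r => <-.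
  by rewrite conjgE !mulgA mulgV mul1g mulgK.
have zb : (zexpg c (e * z) ^ b)%g = zexpg c (e * z).
  by apply/conjg_fixP/commgP; apply: (centsP (cycle_abelian c)); rewrite ?zexpg_cycle.
by rewrite -[RHS]zb -zE conjgE invMg invgK !mulgA.
Qed.

Lemma mtor_trace (t : L) : \tr (mtor t) = t + t^-1.
Proof.
rewrite /mxtrace !big_ord_recl big_ord0 !mxE /= addr0.
by rewrite -mulr2n -[LHS]mulr_natl mulVKf ?two_neq0.
Qed.

Lemma class_trace x (y : SL2 K) : y \in (x ^: [set: SL2 K])%g ->
  \tr (map_mx (iota_ S) y) = \tr (map_mx (iota_ S) x).
Proof.
case/imsetP=> g _ ->; rewrite !trace_map_mx; congr (iota_ S _).
rewrite conjgE -[sl2mx _]/(sl2mx g^-1 *m (sl2mx x *m sl2mx g))%g.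
rewrite mxtrace_mulC -mulmxA -[(sl2mx g *m _)]/(sl2mx (g * g^-1)%g) mulgV.
exact: (congr1 (@mxtrace _ _) (mulmx1 _)).
Qed.

(* Let x, w be the diagonal and b, d the off-diagonal entries of y, m = x - w and
   r = b et - d / et.  The two traces fix x + w = t1 + t1^-1 and
   b et + d / et = t1 - t1^-1, so det y = 1 forces r^2 = m^2; but Frobenius fixes
   m and negates r, whence m = r = 0. *)
Lemma torus_factor (y z : SL2 K) (t1 t2 : L) l :
    (1 <= l <= 2 * h)%N -> t1 != 0 -> t2 != 0 ->
    f ^+ l = t1 * t2 -> (y * z)%g = (c ^+ l)%g ->
    \tr (map_mx (iota_ S) y) = t1 + t1^-1 ->
    \tr (map_mx (iota_ S) z) = t2 + t2^-1 ->
  map_mx (iota_ S) y = mtor t1.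
Proof.
move=> /andP[l0 lh] t10 t20 fl yz try trz.
have n2 := two_neq0 S; have e0 := etil_neq0 S; have f0 := f_neq0 S.
(* [k] is the off-diagonal parameter of c^l. It would vanish only if f^(2l) = 1, which 0 < 2l <= 4h
   < q + 1 excludes. *)
pose k := (t1 * t2 - (t1 * t2)^-1) / 2.
have k0 : k != 0.
  rewrite mulf_neq0 ?invr_eq0 // subr_eq0 -fl; apply/negP=> /eqP fl1.
  have : f ^+ (l + l) == 1 by rewrite exprD {1}fl1 mulVf // expf_neq0.
  by rewrite -(prim_order_dvd (f_prim S)) => /dvdn_leq; rewrite (q_h S); lia.
pose A := map_mx (iota_ S) y.
have dA : A 0 0 * A 1 1 - A 0 1 * A 1 0 = 1 by rewrite -det2 det_map_mx sl2_det rmorph1.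
have AE i j : A i j ^+ q = A i j by rewrite mxE iota_q.
have AZ : A *m map_mx (iota_ S) z = mtor (t1 * t2).
  by rewrite -fl -c_powE -yz; exact/esym/map_mxM.
have E i j := congr1 (fun M : 'M[L]_2 => M i j) AZ.
move: (E 0 0) (E 1 0) (E 0 1) (E 1 1); rewrite /= !mulmx2E {E}.
have tr2 (M : 'M[L]_2) : \tr M = M 0 0 + M 1 1.
  by rewrite /mxtrace !big_ord_recl big_ord0 addr0 (_ : lift ord0 ord0 = 1) //; apply: val_inj.
have MtE : mtor (t1 * t2) 0 0 = mtor (t1 * t2) 1 1 by rewrite !mxE.
rewrite -MtE; move: try trz (AE 0 0) (AE 0 1) (AE 1 0) (AE 1 1) dA; rewrite !tr2 -/A.
set Z := map_mx (iota_ S) z; have -> : mtor (t1 * t2) 0 0 = (t1 * t2 + (t1 * t2)^-1) / 2.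
  by rewrite mxE mulrC.
have -> : mtor (t1 * t2) 0 1 = k / et by rewrite mxE /= mulrC /k; ring.
have -> : mtor (t1 * t2) 1 0 = k * et by rewrite mxE /= /k; ring.
set x := A 0 0; set b := A 0 1; set d := A 1 0; set w := A 1 1 => try trz xq bq dq wq dA.
set a := _ / 2 => E00 E10 E01 E11.
(* Since det y = 1, the inverse of y is its adjugate, so the diagonal of z = y^-1 c^l is linear in
   the entries of y. *)
have Z00 : Z 0 0 = w * a - b * (k * et) by rewrite -E00 -E10 -[LHS]mul1r -dA; ring.
have Z11 : Z 1 1 = x * a - d * (k / et) by rewrite -E01 -E11 -[LHS]mul1r -dA; ring.
(* The trace of z is [(x + w) * a - k * (b * et + d / et)]; its prescribed value determines the
   second factor after division by [k]. *)
have bd : b * et + d / et = t1 - t1^-1.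
  apply: (mulfI k0); transitivity ((x + w) * a - (Z 0 0 + Z 1 1)).
    by rewrite Z00 Z11; ring.
  by rewrite try trz /a /k; field; rewrite ?t10 ?t20 ?n2.
pose m := x - w; pose r := b * et - d / et.
have mq : m ^+ q = m by rewrite /m Defs.addq Defs.oppq xq wq.
have rq : r ^+ q = - r.
  by rewrite /r Defs.addq Defs.oppq !exprMn exprVn bq dq etilq invrN !mulrN opprB opprK addrC.
have rm : r ^+ 2 = m ^+ 2.
  have : (x + w) ^+ 2 - (b * et + d / et) ^+ 2 = 4 by rewrite try bd; field.
  have -> : (x + w) ^+ 2 = m ^+ 2 + 4 * (x * w) by rewrite /m; ring.
  have -> : (b * et + d / et) ^+ 2 = r ^+ 2 + 4 * (b * d) by rewrite /r; field.
  move=> E; apply/eqP; rewrite -subr_eq0.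
  have dA4 : 4 * (x * w) - 4 * (b * d) = 4 by rewrite -mulrBr dA mulr1.
  have -> : r ^+ 2 - m ^+ 2 = 4 * (x * w) - 4 * (b * d) -
    (m ^+ 2 + 4 * (x * w) - (r ^+ 2 + 4 * (b * d))) by ring.
  by rewrite dA4 E subrr.
have m0 : m = 0.
  have mN : m = - m.
    move/eqP: rm; rewrite eqf_sqr => /orP[|] /eqP rE; move: rq; rewrite rE.
      by rewrite mq.
    by rewrite Defs.oppq mq opprK => /esym.
  by apply: (mulfI n2); rewrite mulr0 mulr_natl mulr2n {1}mN addNr.
have r0 : r = 0 by apply/eqP; rewrite -sqrf_eq0 rm m0 expr0n.
have wE : w = x by apply/eqP; rewrite eq_sym -subr_eq0 -/m m0.
have xE : x = 2^-1 * (t1 + t1^-1).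
  by rewrite -try wE -mulr2n -[x *+ 2]mulr_natl mulKf.
have bE : b * et = 2^-1 * (t1 - t1^-1).
  have rE : b * et = d / et by apply/eqP; rewrite -subr_eq0 -/r r0.
  by rewrite -bd -rE -mulr2n -[b * et *+ 2]mulr_natl mulKf.
have dE : d / et = 2^-1 * (t1 - t1^-1).
  by rewrite -bE; apply/eqP; rewrite eq_sym -subr_eq0 -/r r0.
apply/matrixP; apply: ord2P; apply: ord2P; rewrite [RHS]mxE /= -?xE //.
- by rewrite -bE mulfK.
- by rewrite -dE mulfVK.
Qed.

End SL2.

(** * Characters of the cyclic group of c and its action on basis vectors *)

Section Components.
Variables (R : realType) (S : sl2_setting).
Variable T : forall x : SL2 (Fq S), coset_reps x.
Local Notation q := (q_ S).
Local Notation h := (h_ S).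
Local Notation f := (f_ S).
Local Notation c := (c_ S).
Local Notation K := (Fq S).
Local Notation zt := (zeta R q.+1).

Lemma zeta_neq0 m : zeta R m.+1 != 0.
Proof.
apply/eqP=> z0; have /eqP := @zeta_order R m.+1 (ltn0Sn m).
by rewrite z0 expr0n /= eq_sym oner_eq0.
Qed.

Lemma wstar_zexpg (w : 'Z_q.+1) z :
  wstar_fun R w (zexpg c z) 0 0 = zt ^ (z * (w : nat)%:Z).
Proof.
have [n [k [-> ->]]] := zexpg_natP c z; rewrite wstarE mxE eqxx mulr1n c_order.
rewrite mulrBl expfzDr ?zeta_neq0 // -invr_expz -!PoszM -!exprnP.
have -> : zt ^+ (k * q.+1 * w) = 1.
  by rewrite mulnAC mulnC exprM zeta_order // expr1n.
by rewrite invr1 mulr1.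
Qed.

(** ['Z_n] reduces modulo [(Zp_trunc n).+2], which is n as soon as n > 1. *)
Lemma Zp_q : (Zp_trunc q.+1).+2 = q.+1.
Proof. by apply: Zp_cast; rewrite ltnS q_gt0. Qed.

Lemma zeta_ZpD (w1 w2 : 'Z_q.+1) : zt ^+ (w1 + w2)%R = zt ^+ w1 * zt ^+ w2.
Proof. by rewrite /= [X in (_ %% X)%N]Zp_q expr_mod ?zeta_order // exprD. Qed.

(** The natural representative of -w is in general not the negative of that of w; the two powers
    agree because both are inverse to [zt ^+ w]. *)
Lemma zeta_Zp_sign (w : 'Z_q.+1) (e : int) : e = 1 \/ e = -1 ->
  zt ^+ (w *~ e)%R = zt ^ (e * (w : nat)%:Z).
Proof.
case=> ->; first by rewrite mul1r mulr1z.
rewrite mulrN1z mulN1r -invr_expz -exprnP.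
apply: (mulIf (expf_neq0 w (zeta_neq0 q))); rewrite -zeta_ZpD addNr expr0.
by rewrite mulVf // expf_neq0 // zeta_neq0.
Qed.

Lemma zeta_Zp_comb (w1 w2 : 'Z_q.+1) (e1 e2 : int) :
    e1 = 1 \/ e1 = -1 -> e2 = 1 \/ e2 = -1 ->
  zt ^+ (w1 *~ e1 + w2 *~ e2)%R = zt ^ (e1 * (w1 : nat)%:Z + e2 * (w2 : nat)%:Z).
Proof.
by move=> e1P e2P; rewrite zeta_ZpD !zeta_Zp_sign // expfzDr ?zeta_neq0.
Qed.

(** The representative a at degree c^(e l) satisfies a^-1 c^z a = c^(e z), so the sign of the degree
    twists the character. *)
Lemma Cvec_act l (hl : (1 <= l <= 2 * h)%N) (w : 'Z_q.+1) (e z : int) :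
    e = 1 \/ e = -1 ->
  act (Cobj R hl w T) (zexpg c z) (Cvec R hl w T (zexpg c (e * l%:Z))) =
  zt ^ (e * z * (w : nat)%:Z) *: Cvec R hl w T (zexpg c (e * l%:Z)).
Proof.
move=> eP; have yx := sign_pow_class S l eP.
rewrite [LHS]simple_act_vec //; last first.
  by apply: (centsP (cycle_abelian c)); rewrite ?zexpg_cycle.
have ac := rep_atE (T (c ^+ l)%g) yx.
by rewrite (conj_sign_pow _ hl eP ac) /= wstar_zexpg.
Qed.

(** The trace is symmetric in f^l and f^-l, hence blind to the sign. *)
Lemma sign_pow_trace (e : int) l : e = 1 \/ e = -1 ->
  \tr (map_mx (iota_ S) (c ^+ l)%g) = f ^ (e * l%:Z) + (f ^ (e * l%:Z))^-1.
Proof.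
move=> eP; rewrite c_powE mtor_trace.
by case: eP => ->; rewrite ?mul1r // mulN1r -invr_expz invrK addrC.
Qed.

(** The classes of [y] and [z] fix their traces, and for the degenerate triangle [torus_factor]
    recovers [y] from the traces alone. *)
Lemma class_factor l l1 l2 (e1 e2 : int) (y z : SL2 K) :
    (1 <= l <= 2 * h)%N -> e1 = 1 \/ e1 = -1 -> e2 = 1 \/ e2 = -1 ->
    f ^+ l = f ^ (e1 * l1%:Z) * f ^ (e2 * l2%:Z) ->
    y \in ((c ^+ l1) ^: [set: SL2 K])%g -> z \in ((c ^+ l2) ^: [set: SL2 K])%g ->
    (y * z)%g = (c ^+ l)%g ->
  y = zexpg c (e1 * l1%:Z).
Proof.
move=> hl e1P e2P fl yx zx yz; apply: sl2_map_inj; rewrite zexpg_c_E.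
apply: (torus_factor hl _ _ fl yz); rewrite ?expfz_neq0 ?f_neq0 //.
  by rewrite (class_trace yx); apply: sign_pow_trace.
by rewrite (class_trace zx); apply: sign_pow_trace.
Qed.

(** * The tensor product in degree c^l *)

Section Product.
Variables (l l1 l2 : nat) (w1 w2 : 'Z_q.+1) (e1 e2 : int).
Hypotheses (hl : (1 <= l <= 2 * h)%N) (hl1 : (1 <= l1 <= 2 * h)%N)
           (hl2 : (1 <= l2 <= 2 * h)%N).
Hypotheses (he1 : e1 = 1 \/ e1 = -1) (he2 : e2 = 1 \/ e2 = -1).
Hypothesis hf : f ^+ l = f ^ (e1 * l1%:Z) * f ^ (e2 * l2%:Z).
Local Notation X1 := (Cobj R hl1 w1 T).
Local Notation X2 := (Cobj R hl2 w2 T).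
Local Notation cl := (c ^+ l)%g.
Local Notation c1 := (zexpg c (e1 * l1%:Z)).
Local Notation c2 := (zexpg c (e2 * l2%:Z)).
Local Notation v1 := (Cvec R hl1 w1 T c1).
Local Notation v2 := (Cvec R hl2 w2 T c2).

Lemma mul_c1_c2 : (c1 * c2 = cl)%g.
Proof.
apply: sl2_map_inj; rewrite c_powE hf -mtorM ?expfz_neq0 ?f_neq0 // -!zexpg_c_E.
exact: map_mxM.
Qed.

Lemma Cvec_hcomp y m (hm : (1 <= m <= 2 * h)%N) (w : 'Z_q.+1) :
  Cvec R hm w T y \in hcomp (Cobj R hm w T) y.
Proof. by apply/memv_imgP; exists (const_mx 1); rewrite ?memvf ?lfunE. Qed.

Lemma Cvec_neq0 (e : int) m (hm : (1 <= m <= 2 * h)%N) (w : 'Z_q.+1) :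
  e = 1 \/ e = -1 -> Cvec R hm w T (zexpg c (e * m%:Z)) != 0.
Proof. by move=> eP; apply: simple_vec_neq0; apply: sign_pow_class. Qed.

(** It suffices to test homogeneous pure tensors: a factor vanishes when its degree is outside its
    class, and otherwise [class_factor] forces the two degrees. *)
Lemma tensor_hcomp_line : hcomp (ydtensor X1 X2) cl = <[tens v1 v2]>%VS.
Proof.
apply/eqP; rewrite eqEsubv; apply/andP; split; last first.
  by rewrite -memvE -mul_c1_c2; apply: mem_tensor_hcomp; apply: Cvec_hcomp.
apply: tensor_hcomp_subP => y z a b yz ay bz.
have [yx|yx] := boolP (y \in (c ^+ l1) ^: [set: SL2 K])%g; last first.
  by rewrite (simple_hcomp_notin yx ay) tens0l mem0v.
have [zx|zx] := boolP (z \in (c ^+ l2) ^: [set: SL2 K])%g; last first.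
  by rewrite (simple_hcomp_notin zx bz) tens0r mem0v.
have y1 := class_factor hl he1 he2 hf yx zx yz.
have z2 : z = c2 by apply: (mulgI y); rewrite yz y1 mul_c1_c2.
have [k ->] := simple_hcompP ay; have [m ->] := simple_hcompP bz.
by rewrite tensZ memvZ // y1 z2 memv_line.
Qed.

Lemma tensor_act_line j : act (ydtensor X1 X2) (c ^+ j)%g (tens v1 v2) =
  zt ^ ((e1 * (w1 : nat)%:Z + e2 * (w2 : nat)%:Z) * j%:Z) *: tens v1 v2.
Proof.
rewrite [LHS]tensfE -[(c ^+ j)%g]/(zexpg c j) !Cvec_act // tensZ.
by rewrite -expfzDr ?zeta_neq0 // mulrDl mulrAC [e2 * _ * _]mulrAC.
Qed.

(** The weight [w] enters only through its power of zeta, so that both orders of the tensor product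
    can be mapped to literally the same object. *)
Lemma class_part_iso (w : 'Z_q.+1) :
    zt ^+ w = zt ^ (e1 * (w1 : nat)%:Z + e2 * (w2 : nat)%:Z) ->
  exists phi : ydiso (class_part (ydtensor X1 X2) cl) (Cobj R hl w T),
  exists2 t : class_part (ydtensor X1 X2) cl,
    class_incl _ cl t = tens v1 v2 & phi t = Cvec R hl w T cl.
Proof.
move=> wE; set X := ydtensor X1 X2.
have ux : tens v1 v2 \in hcomp X cl by rewrite tensor_hcomp_line memv_line.
have uV : tens v1 v2 \in class_vspace X cl.
  exact: subvP (class_hcomp_sub X (class_refl _ _)) _ ux.
pose t : class_part X cl := vsproj (class_vspace X cl) (tens v1 v2).
have tE : vsval t = tens v1 v2 by rewrite vsprojK.
have [||y yx|b bc|phi phit] := @simple_isoP _ _ cl (T cl) (wstar R hl w) (class_part X cl) t.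
- apply/eqP=> /(congr1 vsval); rewrite tE linear0 => /eqP.
  by rewrite tens_eq0 !(negPf (Cvec_neq0 _ _ _)).
- apply/vspaceP=> s; rewrite mem_class_hcomp tensor_hcomp_line.
  apply/vlineP/vlineP=> -[k kE]; exists k; last by rewrite kE linearZ /= tE.
  by apply: subvs_inj; rewrite kE linearZ /= tE.
- exact: class_part_notin.
- have /cycleP[j ->] : b \in <[c]>%g by rewrite -(cent_c hl).
  apply: subvs_inj; rewrite class_part_actE tE tensor_act_line linearZ /= tE.
  by rewrite wstarE mxE eqxx mulr1n mulnC exprM wE exprnP exprz_exp.
by exists phi, t; rewrite // lfunE.
Qed.

(** The sign [e1] comes from the degree c^(e1 l1) of [v1], which is the acting element, and [e2]
    from the degree of [v2], on which it acts. *)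
Lemma braiding_line :
  braiding X1 X2 (tens v1 v2) = zt ^ (e1 * e2 * l1%:Z * (w2 : nat)%:Z) *: tens v2 v1.
Proof.
have v1c : v1 \in hcomp X1 c1 by apply: Cvec_hcomp.
rewrite [LHS](braid_lfunE _ v1c) Cvec_act // -[v1 in LHS]scale1r tensZ mulr1.
by congr (_ ^ _ *: _); ring.
Qed.

End Product.
End Components.

Theorem mainTheorem7 (R : realType) (S : sl2_setting)
    (T : forall x : SL2 (Fq S), coset_reps x)
    (l l1 l2 : nat)
    (hl : (1 <= l <= 2 * h_ S)%N)
    (hl1 : (1 <= l1 <= 2 * h_ S)%N)
    (hl2 : (1 <= l2 <= 2 * h_ S)%N)
    (w1 w2 : 'Z_(q_ S).+1)
    (e1 e2 : int)
    (he1 : e1 = 1 \/ e1 = -1)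
    (he2 : e2 = 1 \/ e2 = -1)
    (hf : f_ S ^+ l = f_ S ^ (e1 * l1%:Z) * f_ S ^ (e2 * l2%:Z)) :
  let X1 := Cobj R hl1 w1 T in
  let X2 := Cobj R hl2 w2 T in
  let Y := Cobj R hl (w1 *~ e1 + w2 *~ e2) T in
  let cl := (c_ S ^+ l)%g in
  let c1 := zexpg (c_ S) (e1 * l1%:Z) in
  let c2 := zexpg (c_ S) (e2 * l2%:Z) in
  let v1 : X1 := Cvec R hl1 w1 T c1 in
  let v2 : X2 := Cvec R hl2 w2 T c2 in
  let v : Y := Cvec R hl (w1 *~ e1 + w2 *~ e2) T cl in
  exists (phi : ydiso (class_part (ydtensor X1 X2) cl) Y)
         (psi : ydiso (class_part (ydtensor X2 X1) cl) Y),
    [/\ exists2 t : class_part (ydtensor X1 X2) cl,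
          class_incl _ cl t = tens v1 v2 & phi t = v,
        exists2 t : class_part (ydtensor X2 X1) cl,
          class_incl _ cl t = tens v2 v1 & psi t = v
      & (psi \o restr (braiding X1 X2) cl \o iso_inv phi)%VF
        = zeta R (q_ S).+1 ^ (e1 * e2 * l1%:Z * (w2 : nat)%:Z) *: \1%VF].
Proof.
move=> X1 X2 Y cl c1 c2 v1 v2 v.
have hf' : f_ S ^+ l = f_ S ^ (e2 * l2%:Z) * f_ S ^ (e1 * l1%:Z) by rewrite hf mulrC.
have zw := zeta_Zp_comb R w1 w2 he1 he2.
(* Only the integer exponent is commuted; the weight labelling the target stays as it is. *)
have zw' := zw; rewrite [e1 * _ + _]addrC in zw'.
have [phi [t tE phit]] := class_part_iso T hl hl1 hl2 he1 he2 hf zw.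
have [psi [t' t'E psit']] := class_part_iso T hl hl2 hl1 he2 he1 hf' zw'.
exists phi, psi; split; [by exists t | by exists t' |].
have vt : iso_inv phi v = t by rewrite /v -phit -comp_lfunE iso_funK id_lfunE.
have bt : restr (braiding X1 X2) cl t =
    zeta R (q_ S).+1 ^ (e1 * e2 * l1%:Z * (w2 : nat)%:Z) *: t'.
  have tV : vsval t = tens v1 v2 by rewrite -tE lfunE.
  have t'V : vsval t' = tens v2 v1 by rewrite -t'E lfunE.
  apply: subvs_inj; rewrite restr_lfunE linearZ /= tV t'V.
  exact: braiding_line.
(* Composing as morphisms keeps the equivariance, so the value on the generator [v] determines the
   whole endomorphism. *)
apply: (simple_endo_scalar
  (f := ydcomp (ydcomp psi (restr (braiding X1 X2) cl)) (iso_inv phi))).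
by rewrite /= !comp_lfunE [iso_inv phi _]vt bt linearZ /= psit'.
Qed.
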